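(* Every planar graph $G$ that contains no cycle of length $4$ and no cycle of length $5$ has independence ratio at least $\frac{3}{11}$, i.e. $\frac{\alpha(G)}{|V(G)|}\ge \frac{3}{11}$.
   Context: Graphs are finite and simple (with at least one vertex). ''Without cycles of length $4$ or $5$'' means that $G$ has no subgraph (not necessarily induced) isomorphic to the cycle $C_4$ or $C_5$. The independence number $\alpha(G)$ is the size of a largest independent set in $G$, and the independence ratio of $G$ is $\frac{\alpha(G)}{|V(G)|}$. *)

(* Defs.v *)
From mathcomp Require Import all_boot all_order all_algebra.
From mathcomp Require Import all_classical all_reals all_analysis.

Set Implicit Arguments.
Unset Strict Implicit.
Unset Printing Implicit Defensive.

Import Order.TTheory GRing.Theory Num.Theory.
Import numFieldNormedType.Exports.

Local Open Scope ring_scope.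

(* A finite simple graph is a finType T of vertices with a symmetric and
   irreflexive adjacency relation e.  *)

Section Combinatorics.
Variables (T : finType) (e : rel T).

(* For k >= 3, a uniq closed walk of length k is a (not necessarily induced)
   subgraph isomorphic to C_k. *)
Definition has_cycle (k : nat) : Prop := exists c : k.-tuple T, ucycle e c.

Definition independent (S : {set T}) : bool :=
  [forall x in S, forall y in S, ~~ e x y].

Definition independence_number : nat :=
  (\max_(S : {set T} | independent S) #|S|)%N.

Definition independence_ratio : rat :=
  independence_number%:R / #|T|%:R.

End Combinatorics.

Section Planarity.
Variable R : realType.

(* By compactness of [0, 1], the map g is a homeomorphism onto its image. *)
Definition is_arc (a b : R * R) (C : set (R * R)) : Prop :=
  exists g : R -> R * R,
    [/\ {within `[0, 1], continuous g}%classic,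
        {in `[0, 1] &, injective g},
        g 0 = a, g 1 = b & C = (g @` `[0, 1])%classic].

(* Arcs are indexed by the unordered pair of ends of an edge; the values of
   arc at other sets are irrelevant.  The last two clauses say that the
   interior of an edge contains no vertex and no point of any other edge. *)
Definition plane_drawing (T : finType) (e : rel T)
    (pos : T -> R * R) (arc : {set T} -> set (R * R)) : Prop :=
  [/\ injective pos,
      forall x y, e x y -> is_arc (pos x) (pos y) (arc [set x; y]%SET),
      forall x y z, e x y -> arc [set x; y]%SET (pos z) -> z = x \/ z = y
    & forall x y u v, e x y -> e u v -> [set x; y]%SET != [set u; v]%SET ->
        (arc [set x; y]%SET `&` arc [set u; v]%SET `<=` range pos)%classic].

Definition planar (T : finType) (e : rel T) : Prop :=
  exists pos arc, @plane_drawing T e pos arc.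

End Planarity.

(* Main.v *)
(* For a vertex set S with n vertices, e edges and t triangles put
   W(S) = 4e - 3t - 6n, the sum over S of w(v) = 2 d(v) - t(v) - 6.

   Planarity forces W(S) < 0.  A plane drawing exhibits G as a minor of the
   square grid.  Assigning to each unit square the functional that sends a cycle
   to its winding parity around the square, one obtains, as in MacLane's
   criterion, a family of even edge sets that spans the cycle space and covers
   every edge at most twice.  A basis taken from it has at least e - n + 1
   members, each of which is a triangle or has at least 6 edges, so
   6(e - n + 1) <= 2e + 3t.

   On the other hand 44 alpha(S) + tau(S) >= 12 n - W(S), where tau counts the
   components of G[S] that are triangles.  In a minimal counterexample, deleting
   closed neighbourhoods of independent sets shows that all degrees are at least
   3, that vertices of degree 3 at distance 2 do not occur, and that two adjacent
   vertices of degree 3, each in a triangle not containing the other, have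
   neighbours of degree at least 5.  Only vertices of degree 3 in a triangle have
   w(v) = -1 < 0, and each of them can be paired with its own vertex of weight at
   least 1, so W(S) >= 0, a contradiction.  Since tau only matters for triangle
   components, which have independence ratio 1/3, alpha >= 3n/11 follows. *)
Require Import Defs.
From mathcomp Require Import all_boot all_order all_algebra.
From mathcomp Require Import boolp zify ring lra.

Set Implicit Arguments.
Unset Strict Implicit.
Unset Printing Implicit Defensive.

(** * Degrees and triangles under deletion *)

Section Counting.
Variables (T : finType) (e : rel T).
Hypotheses (e_sym : symmetric e) (e_irr : irreflexive e).

Definition neighbours (S : {set T}) v := [set y in S | e v y].
Definition degree S v := #|neighbours S v|.
(* Counts ordered pairs, hence twice the number of triangles of S at v. *)
Definition tri_at S v :=
  \sum_(y in neighbours S v) #|neighbours S v :&: neighbours S y|.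

Local Notation nbr := neighbours.
Local Notation deg := degree.
Local Notation tri := tri_at.

Definition C4_free := forall a b c d,
  e a b -> e b c -> e c d -> e d a -> a != c -> b != d -> False.
Definition C5_free := forall a b c d f,
  e a b -> e b c -> e c d -> e d f -> e f a -> uniq [:: a; b; c; d; f] -> False.

Lemma e_neq x y : e x y -> x != y.
Proof. by apply: contraTneq => ->; rewrite e_irr. Qed.

Lemma in_nbr S v y : (y \in nbr S v) = (y \in S) && e v y.
Proof. by rewrite inE. Qed.

(** Orienting every edge by [enum_rank] splits the double sum into two equal halves. *)
Lemma sum_sym_even (A : {set T}) :
  ~~ odd (\sum_(y in A) \sum_(z in A) e y z).
Proof.
pose f (y z : T) := (e y z && (enum_rank y < enum_rank z)) : nat.
have -> : \sum_(y in A) \sum_(z in A) e y z =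
   \sum_(y in A) \sum_(z in A) f y z + \sum_(y in A) \sum_(z in A) f z y.
  rewrite -big_split; apply: eq_bigr => y _; rewrite -big_split.
  apply: eq_bigr => z _; rewrite /f /= (e_sym z).
  case: (boolP (e y z)) => //= /e_neq.
  by rewrite -(inj_eq enum_rank_inj) -(inj_eq val_inj) /=; lia.
by rewrite [X in _ + X]exchange_big /= addnn odd_double.
Qed.

Lemma card_nbr_cap (S A : {set T}) v : A \subset S ->
  #|A :&: nbr S v| = \sum_(z in A) e v z.
Proof.
move=> /subsetP AS; rewrite -sum1_card big_mkcond [RHS]big_mkcond /=.
apply: eq_bigr => z _; rewrite !inE; case: (boolP (z \in A)) => //= /AS -> /=.
by case: e.
Qed.

Lemma nbr_sub S v : nbr S v \subset S.
Proof. by apply/subsetP => y; rewrite inE => /andP[]. Qed.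

Lemma tri_even S v : ~~ odd (tri S v).
Proof.
rewrite /tri (eq_bigr (fun y => \sum_(z in nbr S v) e y z)) ?sum_sym_even //.
by move=> y _; rewrite card_nbr_cap // nbr_sub.
Qed.

Lemma e_out_sym (D R : {set T}) :
  \sum_(v in D) #|nbr R v| = \sum_(v in R) #|nbr D v|.
Proof.
have E (A B : {set T}) :
   \sum_(v in A) #|nbr B v| = \sum_(v in A) \sum_(w in B) e v w.
  apply: eq_bigr => v _; rewrite -(card_nbr_cap v (subxx B)).
  by rewrite (setIidPr (nbr_sub _ _)).
rewrite !E exchange_big; apply: eq_bigr => v _; apply: eq_bigr => w _.
by rewrite e_sym.
Qed.

Section Free.
Hypothesis noC4 : C4_free.

(** Two common neighbours of [v] and [y] would close a 4-cycle with them. In particular an edge lies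
    in at most one triangle. *)
Lemma codeg_le1 S v y : v != y -> #|nbr S v :&: nbr S y| <= 1.
Proof.
move=> vy; rewrite leqNgt; apply/negP => /card_gt1P[a [b [ha hb ab]]].
move: ha hb; rewrite !inE => /andP[/andP[_ va] /andP[_ ya]].
move=> /andP[/andP[_ vb] /andP[_ yb]].
by apply: (noC4 va _ yb _ vy ab); rewrite e_sym.
Qed.

Lemma tri_le_deg S v : tri S v <= deg S v.
Proof.
rewrite /deg -sum1_card; apply: leq_sum => y; rewrite inE => /andP[_ vy].
by apply: codeg_le1; apply: e_neq.
Qed.

(** Every edge at [v] contributes at most 1 to [tri_at], and the edge [vc] contributes 0. *)
Lemma tri_lt_deg S v c : c \in nbr S v -> nbr S v :&: nbr S c = set0 ->
  tri S v < deg S v.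
Proof.
move=> cv c0; rewrite /deg /tri (bigD1 c) //= c0 cards0 add0n (cardsD1 c) cv.
rewrite add1n ltnS -sum1_card.
rewrite [X in _ <= X](eq_bigl (fun i => (i \in nbr S v) && (i != c))); last first.
  by move=> i; rewrite !inE andbC.
apply: leq_sum => y /andP[]; rewrite inE => /andP[_ vy] _.
by apply: codeg_le1; apply: e_neq.
Qed.

Lemma deg_split (S D : {set T}) v : D \subset S ->
  deg S v = deg D v + deg (S :\: D) v.
Proof.
move=> DS; rewrite /deg -(cardsID D (nbr S v)); congr addn; apply: eq_card.
  move=> y; rewrite !inE; case: (boolP (y \in D)) => //=; last by rewrite andbF.
  by move/(subsetP DS) => ->; rewrite andbT.
by move=> y; rewrite !inE andbA.
Qed.

Lemma sum_split (S D : {set T}) (F : T -> nat) : D \subset S ->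
  \sum_(v in S) F v = \sum_(v in D) F v + \sum_(v in S :\: D) F v.
Proof.
by move=> DS; rewrite (big_setID D) /= (setIidPr DS).
Qed.

(** An edge leaving [D] is counted at both ends: in the first sum at its end in [D], in the second
    on behalf of its end outside [D]. *)
Lemma deg_sum_del (S D : {set T}) : D \subset S ->
  \sum_(v in S) deg S v = \sum_(v in D) deg S v
    + \sum_(v in D) deg (S :\: D) v + \sum_(v in S :\: D) deg (S :\: D) v.
Proof.
move=> DS; rewrite (sum_split _ DS) -addnA; congr (_ + _).
rewrite [X in X + _]e_out_sym -big_split; apply: eq_bigr => v _ /=.
exact: deg_split.
Qed.

(* Every ordered triangle (v, y, z) lost at a surviving vertex v has y or z in
   the deleted set, and the edge vy lies in at most one triangle. *)
Lemma tri_del (S D : {set T}) v : D \subset S ->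
  tri S v <= tri (S :\: D) v + 2 * deg D v.
Proof.
move=> DS; set R := S :\: D.
have E (A : {set T}) : tri A v = \sum_(y in nbr A v) \sum_(z in nbr A v) e y z.
  by apply: eq_bigr => y _; rewrite card_nbr_cap // nbr_sub.
have ND : nbr D v \subset nbr S v.
  by apply/subsetP => y; rewrite !inE => /andP[/(subsetP DS) -> ->].
have NR : nbr S v :\: nbr D v = nbr R v.
  apply/setP => y; rewrite !inE; case: (e v y); rewrite ?andbF ?andbT //.
have b1 (y : T) : y \in nbr S v -> \sum_(z in nbr S v) e y z <= 1.
  rewrite inE => /andP[yS vy]; rewrite -(card_nbr_cap y (nbr_sub S v)).
  by apply: codeg_le1; apply: e_neq.
rewrite E (sum_split _ ND) NR.
have H1 : \sum_(y in nbr D v) \sum_(z in nbr S v) e y z <= deg D v.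
  by rewrite /deg -sum1_card; apply: leq_sum => y /(subsetP ND); apply: b1.
have H2 : \sum_(y in nbr R v) \sum_(z in nbr S v) e y z =
    \sum_(y in nbr R v) \sum_(z in nbr D v) e y z + tri R v.
  by rewrite E -big_split; apply: eq_bigr => y _; rewrite (sum_split _ ND) NR.
have H3 : \sum_(y in nbr R v) \sum_(z in nbr D v) e y z <= deg D v.
  rewrite exchange_big /= /deg -sum1_card; apply: leq_sum => y yD.
  apply: leq_trans (b1 y (subsetP ND _ yD)).
  rewrite [X in _ <= X](sum_split _ ND) NR.
  under eq_bigr do rewrite e_sym.
  exact: leq_addl.
by lia.
Qed.

Lemma tri_sum_del (S D : {set T}) : D \subset S ->
  \sum_(v in S) tri S v <= \sum_(v in D) tri S v
    + 2 * \sum_(v in D) deg (S :\: D) v + \sum_(v in S :\: D) tri (S :\: D) v.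
Proof.
move=> DS; rewrite (sum_split _ DS) -addnA leq_add2l.
rewrite [X in 2 * X]e_out_sym big_distrr -big_split /=.
by apply: leq_sum => v _; rewrite addnC; apply: tri_del.
Qed.

End Free.
End Counting.

(** * The potential *)

Section Potential.
Variables (T : finType) (e : rel T).
Hypotheses (e_sym : symmetric e) (e_irr : irreflexive e).
Hypotheses (noC4 : C4_free e) (noC5 : C5_free e).

Local Notation nbr := (neighbours e).
Local Notation deg := (degree e).
Local Notation tri := (tri_at e).

Definition closed_nbr (S : {set T}) v := v |: nbr S v.
Local Notation clnbr := closed_nbr.

(** A triangle is a whole component exactly when its three vertices share one closed
    neighbourhood. *)
Definition K3_vertices (S : {set T}) := [set v in S |
  (#|clnbr S v| == 3) && [forall x in clnbr S v, clnbr S x == clnbr S v]].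

Local Notation K3_verts := K3_vertices.

(* Six times 44 alpha + tau >= 18 n + 3 t - 4 e, in terms of the sums of degrees
   (2 e), of tri_at (6 t), and of the size of K3_vertices (3 tau). *)
Definition potential_bound (S : {set T}) := exists I : {set T},
  [/\ I \subset S, independent e I &
   108 * #|S| + 3 * \sum_(v in S) tri S v <=
   264 * #|I| + 12 * \sum_(v in S) deg S v + 2 * #|K3_verts S|].

Lemma independentP (I : {set T}) :
  reflect (forall x y, x \in I -> y \in I -> ~~ e x y) (independent e I).
Proof.
apply: (iffP forallP) => [H x y xI yI|H x].
  by have /implyP/(_ xI)/forallP/(_ y)/implyP/(_ yI) := H x.
by apply/implyP => xI; apply/forallP => y; apply/implyP; apply: H.
Qed.

Lemma card_clnbr S v : #|clnbr S v| = (deg S v).+1.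
Proof. by rewrite cardsU1 inE e_irr andbF. Qed.

Lemma in_clnbr S v y : (y \in clnbr S v) = (y == v) || (y \in S) && e v y.
Proof. by rewrite !inE. Qed.

Lemma clnbr_sub (S : {set T}) v : v \in S -> clnbr S v \subset S.
Proof.
by move=> vS; rewrite subUset sub1set vS nbr_sub.
Qed.

Lemma deg_sub (A B : {set T}) v : A \subset B -> deg A v <= deg B v.
Proof.
move=> AB; apply: subset_leq_card; apply/subsetP => y; rewrite !inE.
by case/andP => /(subsetP AB) -> ->.
Qed.

(** Since [tri_at] is even and at most the degree, degrees 1, 2, 3, 4 allow at most 0, 2, 2, 4. The
    first bound keeps the truncated subtraction exact. *)
Lemma weight_ge S v : [/\ 12 * deg S v >= 3 * tri S v,
  deg S v = 1 -> 12 <= 12 * deg S v - 3 * tri S v,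
  deg S v = 2 -> 18 <= 12 * deg S v - 3 * tri S v,
  deg S v >= 3 -> 30 <= 12 * deg S v - 3 * tri S v &
  deg S v >= 4 -> 36 <= 12 * deg S v - 3 * tri S v].
Proof.
have := tri_le_deg e_sym e_irr noC4 S v.
have := tri_even e_sym e_irr S v.
split; move: (deg S v) (tri S v) H H0; try lia.
Qed.

(** The set [I] is joined to an independent set of the rest. An edge leaving [D] brings 12 through
    its outer end, and the triangles lost there cost at most 3 * 2, which leaves the coefficient
    6. *)
Lemma potential_del (S D I : {set T}) : D \subset S -> I \subset D ->
  independent e I -> (forall x y, x \in I -> y \in S :\: D -> ~~ e x y) ->
  potential_bound (S :\: D) ->
  108 * #|D| + 3 * \sum_(v in D) tri S v + 2 * #|K3_verts (S :\: D)| <=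
    264 * #|I| + 12 * \sum_(v in D) deg S v
    + 6 * \sum_(v in D) deg (S :\: D) v + 2 * #|K3_verts S| ->
  potential_bound S.
Proof.
move=> DS ID /independentP indI sep [J [JR /independentP indJ HJ]] H.
exists (I :|: J); split.
- rewrite subUset (subset_trans ID DS) (subset_trans JR) //.
  exact: subsetDl.
- apply/independentP => x y; rewrite !inE.
  case/orP => [xI|xJ] /orP[yI|yJ]; first exact: indI.
  + by apply: sep => //; apply: (subsetP JR).
  + by rewrite e_sym; apply: sep => //; apply: (subsetP JR).
  + exact: indJ.
have -> : #|I :|: J| = #|I| + #|J|.
  rewrite cardsU (_ : I :&: J = set0) ?cards0 ?subn0 //.
  apply/setP => x; rewrite !inE; apply/negbTE/negP => /andP[/(subsetP ID) xD].
  by move/(subsetP JR); rewrite inE xD.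
have := deg_sum_del e_sym DS.
have := tri_sum_del e_sym e_irr noC4 DS.
have : #|S| = #|D| + #|S :\: D|.
  by rewrite -(cardsID D S) (setIidPr DS).
lia.
Qed.

Lemma leq_card_bigcup (P : pred T) (F : T -> {set T}) :
  #|\bigcup_(y | P y) F y| <= \sum_(y | P y) #|F y|.
Proof.
elim/big_rec2: _ => [|y n A _ IH]; first by rewrite cards0.
by apply: leq_trans (leq_card_setU _ _) _; rewrite leq_add2l.
Qed.

(** A triangle component that appears only after deleting [D] had an edge to [D]; such an edge pays
    for the three vertices of its component. *)
Lemma K3_verts_le_out (S D : {set T}) : D \subset S -> K3_verts S = set0 ->
  #|K3_verts (S :\: D)| <= 3 * \sum_(v in D) deg (S :\: D) v.
Proof.
move=> DS K0; set R := S :\: D.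
have sub : K3_verts R \subset
   \bigcup_(y in R | 0 < deg D y) (if y \in K3_verts R then clnbr R y else set0).
  apply/subsetP => v vK; move: (vK); rewrite inE => /and3P[vR c3 /forallP allv].
  case: (boolP [exists y in clnbr R v, 0 < deg D y]) => [/existsP[y /andP[yv Dy]]|].
    have /implyP/(_ yv)/eqP cy := allv y.
    have yR : y \in R by move: yv; rewrite in_clnbr => /orP[/eqP->|/andP[]].
    apply/bigcupP; exists y; first by rewrite yR.
    have -> : y \in K3_verts R by rewrite inE yR cy c3 /=; apply/forallP.
    by rewrite cy !inE eqxx.
  rewrite negb_exists => /forallP noD; exfalso.
  have cS y : y \in clnbr R v -> clnbr S y = clnbr R y.
    move=> yv; have := noD y; rewrite yv /= -leqNgt leqn0 cards_eq0 => /eqP/setP D0.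
    apply/setP => z; rewrite !in_clnbr !inE; congr (_ || _).
    by have := D0 z; rewrite !inE; case: (z \in D); case: (e y z); rewrite ?andbF ?andbT.
  have vv : v \in clnbr R v by rewrite !inE eqxx.
  suff: v \in K3_verts S by rewrite K0 inE.
  rewrite inE cS // c3 /=; apply/andP; split.
    by move: vR; rewrite inE => /andP[].
  by apply/forallP => x; apply/implyP => xv; rewrite cS //; apply: (implyP (allv x)).
apply: leq_trans (subset_leq_card sub) _.
apply: leq_trans (leq_card_bigcup _ _) _ => /=.
rewrite (e_out_sym e_sym) big_distrr /= big_mkcondr; apply: leq_sum => y yR.
case: ifP => [Dy|_]; last by [].
case: ifP => [|_]; last by rewrite cards0.
rewrite inE => /and3P[_ /eqP -> _]; rewrite -[deg D y]/#|nbr D y| in Dy; lia.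
Qed.
End Potential.

(** * A minimal counterexample *)

Section Minimal.
Variables (T : finType) (e : rel T).
Hypotheses (e_sym : symmetric e) (e_irr : irreflexive e).
Hypotheses (noC4 : C4_free e) (noC5 : C5_free e).

Local Notation nbr := (neighbours e).
Local Notation deg := (degree e).
Local Notation tri := (tri_at e).
Local Notation clnbr := (closed_nbr e).
Local Notation K3_verts := (K3_vertices e).

Variable S : {set T}.
Hypothesis IH : forall R : {set T}, R \proper S -> potential_bound e R.
Hypothesis notS : ~ potential_bound e S.

(** Otherwise [I] would extend an independent set of the smaller set [S :\: D], and [S] would
    satisfy the potential bound. *)
Lemma minimal_del (D I : {set T}) : D \subset S -> I \subset D -> I != set0 ->
  independent e I -> (forall x, x \in I -> nbr S x \subset D) ->
  264 * #|I| + 12 * \sum_(v in D) deg S v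
    + 6 * \sum_(v in D) deg (S :\: D) v + 2 * #|K3_verts S| <
  108 * #|D| + 3 * \sum_(v in D) tri S v + 2 * #|K3_verts (S :\: D)|.
Proof.
move=> DS ID /set0Pn[x xI] indI sep; rewrite ltnNge; apply/negP => H.
apply: notS; apply: (potential_del e_sym e_irr noC4 DS ID indI _ _ H).
  move=> y z yI; rewrite inE => /andP[zD zS]; apply: contra zD => yz.
  by apply: (subsetP (sep _ yI)); rewrite inE zS.
apply: IH; rewrite properEneq subsetDl andbT; apply/negP => /eqP/setP/(_ x).
by rewrite inE (subsetP ID x xI) (subsetP DS) // (subsetP ID).
Qed.

Lemma independent1 v : independent e [set v].
Proof.
by apply/independentP => x y /set1P-> /set1P->; rewrite e_irr.
Qed.

Lemma minimal_del1 v : v \in S ->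
  264 + 12 * \sum_(x in clnbr S v) deg S x
    + 6 * \sum_(x in clnbr S v) deg (S :\: clnbr S v) x + 2 * #|K3_verts S| <
  108 * (deg S v).+1 + 3 * \sum_(x in clnbr S v) tri S x
    + 2 * #|K3_verts (S :\: clnbr S v)|.
Proof.
move=> vS; have vv : [set v] \subset clnbr S v by rewrite sub1set !inE eqxx.
have := @minimal_del (clnbr S v) [set v] (clnbr_sub e vS) vv _ (independent1 v).
rewrite cards1 muln1 card_clnbr //; apply.
  by apply/set0Pn; exists v; rewrite set11.
by move=> x /set1P->; apply: subsetUr.
Qed.

(** Removing a triangle component is exactly balanced, 108 * 3 + 3 * 6 = 264 + 12 * 6 + 2 * 3, where
    the last term is the share of the component in [K3_vertices]. *)
Lemma K3_0 : K3_verts S = set0.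
Proof.
apply/eqP; apply: contraT => /set0Pn[v vK]; exfalso.
move: (vK); rewrite inE => /and3P[vS /eqP c3 /forallP allv].
set D := clnbr S v in c3 allv.
have DS : D \subset S by apply: clnbr_sub.
have eqD x : x \in D -> clnbr S x = D.
  by move=> xD; apply/eqP; apply: (implyP (allv x)).
have degD x : x \in D -> deg S x = 2.
  by move=> /eqD xD; have := card_clnbr e_irr S x; rewrite xD c3 => -[].
have sep x y : x \in D -> y \in S :\: D -> e x y = false.
  move=> xD; rewrite inE => /andP[yD yS]; apply: contraNF yD => xy.
  by rewrite -(eqD x xD) in_clnbr yS xy orbT.
have := minimal_del1 vS; rewrite -/D.
have -> : \sum_(x in D) deg S x = \sum_(x in D) 2.
  by apply: eq_bigr => x /degD.
have : \sum_(x in D) tri S x <= \sum_(x in D) 2.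
  by apply: leq_sum => x /degD <-; apply: tri_le_deg.
rewrite sum_nat_const c3 (degD v); last by rewrite !inE eqxx.
have : #|D| + #|K3_verts (S :\: D)| <= #|K3_verts S|.
  have dis : [disjoint D & K3_verts (S :\: D)].
    rewrite -setI_eq0; apply/eqP/setP => x; rewrite in_set0 in_setI.
    by apply/negP => /andP[xD]; rewrite inE inE xD.
  have := leq_card_setU D (K3_verts (S :\: D)); rewrite dis => /leqifP/eqP <-.
  apply: subset_leq_card; rewrite subUset; apply/andP; split.
    apply/subsetP => x xD; rewrite inE (subsetP DS) //= eqD // c3 eqxx /=.
    by apply/forallP.
  have cR x : x \in S :\: D -> clnbr (S :\: D) x = clnbr S x.
    move=> xR; apply/setP => y; rewrite !in_clnbr; congr (_ || _).
    rewrite inE; case: (boolP (y \in D)) => //= yD.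
    by rewrite e_sym sep // andbF.
  apply/subsetP => x; rewrite inE => /and3P[xR x3 /forallP allx].
  rewrite inE; have /setDP[-> _] := xR; rewrite -cR // x3 /=.
  apply/forallP => y; apply/implyP => yx.
  rewrite -cR; first by apply: (implyP (allx y)).
  by move: yx; rewrite in_clnbr => /orP[/eqP->|/andP[]].
by rewrite c3; lia.
Qed.

(** The new triangle components cost at most 2 * 3 per edge leaving the closed neighbourhood, and
    this is cancelled by the 6 that each such edge brings. *)
Lemma minimal_weight v : v \in S ->
  264 + \sum_(x in clnbr S v) (12 * deg S x - 3 * tri S x)
  < 108 * (deg S v).+1.
Proof.
move=> vS; have := minimal_del1 vS.
have := K3_verts_le_out e_sym (clnbr_sub e vS) K3_0; rewrite K3_0 cards0.
have : \sum_(x in clnbr S v) (12 * deg S x - 3 * tri S x)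
   + 3 * \sum_(x in clnbr S v) tri S x = 12 * \sum_(x in clnbr S v) deg S x.
  rewrite !big_distrr -big_split; apply: eq_bigr => x _ /=.
  by case: (weight_ge e_sym e_irr noC4 S x) => *; rewrite subnK.
lia.
Qed.

(** For degree at most 1 the constant 264 alone exceeds 108 * 2. *)
Lemma deg_gt1 v : v \in S -> 1 < deg S v.
Proof.
move=> vS; have := minimal_weight vS; lia.
Qed.

(** For degree 2 the three weights in the closed neighbourhood sum to less than 324 - 264 = 60,
    while each is at least 18. A weight of 24 or more is therefore excluded, so all three vertices
    have degree 2 and [v] lies in a triangle, which is then a component. *)
Lemma min_deg v : v \in S -> 2 < deg S v.
Proof.
move=> vS; have := deg_gt1 vS; rewrite leq_eqVlt => /orP[/eqP dv|//]; exfalso.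
have w18 x : x \in S -> 18 <= 12 * deg S x - 3 * tri S x.
  move=> /deg_gt1; case: (weight_ge e_sym e_irr noC4 S x) => _ _ w2 w3 _.
  by rewrite leq_eqVlt => /orP[/eqP/esym/w2|/w3] //; lia.
have := minimal_weight vS; rewrite -dv.
have cS x : x \in clnbr S v -> x \in S by apply/subsetP/clnbr_sub.
have [[x xv wx]|all] : (exists2 x, x \in clnbr S v & 24 <= 12 * deg S x - 3 * tri S x)
     \/ (forall x, x \in clnbr S v -> 12 * deg S x - 3 * tri S x < 24).
- case: (boolP [exists x in clnbr S v, 24 <= 12 * deg S x - 3 * tri S x]).
    by case/exists_inP => x xv wx; left; exists x.
  by rewrite negb_exists_in => /forall_inP H; right => x /H; rewrite -ltnNge.
- rewrite (bigD1 x) //= => H; have : 36 <= \sum_(y in clnbr S v | y != x)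
      (12 * deg S y - 3 * tri S y); last by lia.
  apply: leq_trans (_ : \sum_(y in clnbr S v | y != x) 18 <= _); last first.
    by apply: leq_sum => y /andP[/cS/w18].
  have := card_clnbr e_irr S v; rewrite (cardsD1 x) xv -dv => -[c].
  rewrite (eq_bigl (mem (clnbr S v :\ x))) ; first by rewrite sum_nat_const; lia.
  by move=> y; rewrite /= !inE [RHS]andbC.
- move=> _.
  have d2 x : x \in clnbr S v -> deg S x = 2.
    move=> xv; have := all x xv; case: (weight_ge e_sym e_irr noC4 S x) => _ _ _ w3 _.
    have := deg_gt1 (cS x xv); rewrite leq_eqVlt => /orP[/eqP->//|/w3]; lia.
  have vv : v \in clnbr S v by rewrite !inE eqxx.
  have tv : tri S v != 0 by have := all v vv; rewrite -dv; lia.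
  suff : v \in K3_verts S by rewrite K3_0 inE.
  have [a [b [ab Nv]]] : exists a b, a != b /\ nbr S v = [set a; b].
    by move/eqP: dv; rewrite eq_sym => /cards2P[a [b]]; exists a, b.
  have /andP[aS va] : (a \in S) && e v a by rewrite -in_nbr Nv !inE eqxx.
  have /andP[bS vb] : (b \in S) && e v b by rewrite -in_nbr Nv !inE eqxx orbT.
  have eab : e a b.
    apply: contraT => nab; case/eqP: tv; rewrite /tri big1 // => y yN.
    apply/eqP; rewrite cards_eq0; apply/eqP/setP => z; rewrite in_setI in_set0.
    apply/negbTE; move: yN; rewrite Nv in_nbr.
    move=> /set2P[]->; rewrite !inE; apply/negP => /andP[/orP[]/eqP->];
      rewrite ?e_irr ?andbF // ?(negbTE nab) ?andbF //.
    by rewrite e_sym (negbTE nab) andbF.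
  have avb : v != a /\ v != b by rewrite !(e_neq e_irr).
  have cv : clnbr S v = [set v; a; b].
    by rewrite /closed_nbr Nv setUA.
  have sub2 x y z : [set y; z] \subset nbr S x -> y != z -> deg S x = 2 ->
      nbr S x = [set y; z].
    by move=> sub yz dx; apply/esym/eqP; rewrite eqEcard sub cards2 yz -dx /=.
  have ca : clnbr S a = clnbr S v.
    rewrite cv /closed_nbr (sub2 a v b) ?d2 ?cv ?inE ?eqxx ?orbT //; last by case: avb.
      by apply/setP => x; rewrite !inE; do 3!case: eqP.
    by rewrite subUset !sub1set !inE vS bS e_sym va.
  have cb : clnbr S b = clnbr S v.
    rewrite cv /closed_nbr (sub2 b v a) ?d2 ?cv ?inE ?eqxx ?orbT //; last by case: avb.
      by apply/setP => x; rewrite !inE; do 3!case: eqP.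
    by rewrite subUset !sub1set !inE vS aS e_sym vb e_sym.
  rewrite inE vS card_clnbr // -dv eqxx /=; apply/forall_inP => x.
  by rewrite {1}cv !inE -orbA => /or3P[]/eqP->; rewrite ?ca ?cb.
Qed.

(** Minimum degree 3 improves the factor 3 to 1: each vertex of a triangle component of the rest has
    degree 2 there, so it sends an edge of its own to [D]. *)
Lemma K3_le_out (D : {set T}) : D \subset S ->
  #|K3_verts (S :\: D)| <= \sum_(v in D) deg (S :\: D) v.
Proof.
move=> DS; rewrite (e_out_sym e_sym) -sum1_card.
rewrite [X in _ <= X](bigID (mem (K3_verts (S :\: D)))) /=.
apply: leq_trans (leq_addr _ _); rewrite [X in _ <= X](eq_bigl (mem (K3_verts (S :\: D)))).
  apply: leq_sum => v /=; rewrite inE => /and3P[vR /eqP c3 _].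
  have := card_clnbr e_irr (S :\: D) v; rewrite c3 => -[d2].
  have vS : v \in S by move: vR; rewrite inE => /andP[].
  have := min_deg vS; rewrite (deg_split e v DS) -d2.
  by rewrite -[#|nbr D v|]/(deg D v); lia.
by move=> v /=; rewrite !inE; case: (v \in D); case: (v \in S).
Qed.

Lemma weight_ge3 v : v \in S -> 30 <= 12 * deg S v - 3 * tri S v.
Proof.
by move/min_deg; case: (weight_ge e_sym e_irr noC4 S v) => _ _ _.
Qed.

Lemma minimal_del_out (D I : {set T}) : D \subset S -> I \subset D -> I != set0 ->
  independent e I -> (forall x, x \in I -> nbr S x \subset D) ->
  264 * #|I| + 6 * \sum_(v in D) deg (S :\: D) v
    + \sum_(v in D) (12 * deg S v - 3 * tri S v) <
  108 * #|D| + 2 * #|K3_verts (S :\: D)|.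
Proof.
move=> DS ID I0 indI sep.
have := minimal_del DS ID I0 indI sep.
have : \sum_(x in D) (12 * deg S x - 3 * tri S x)
   + 3 * \sum_(x in D) tri S x = 12 * \sum_(x in D) deg S x.
  rewrite !big_distrr -big_split; apply: eq_bigr => x _ /=.
  by case: (weight_ge e_sym e_irr noC4 S x) => *; rewrite subnK.
lia.
Qed.

Lemma deg_cap (D : {set T}) v : D \subset S -> deg D v = #|D :&: nbr S v|.
Proof.
move=> DS; apply: eq_card => y; rewrite !inE.
by case: (boolP (y \in D)) => //= /(subsetP DS) ->.
Qed.

(* Within the union of two closed neighbourhoods sharing only p, all adjacencies
   are those to the two centres and those of the triangles at the centres:
   anything else closes a 4-cycle or a 5-cycle. *)
Lemma no_close u u' p : u \in S -> u' \in S -> deg S u = 3 -> deg S u' = 3 ->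
  u != u' -> p \in nbr S u -> p \in nbr S u' -> e u u'.
Proof.
move=> uS u'S du du' uu' pu pu'; apply: contraT => nuu'; exfalso.
pose D := clnbr S u :|: clnbr S u'.
have DS : D \subset S by rewrite subUset !clnbr_sub.
have [uD u'D] : u \in D /\ u' \in D by rewrite !inE !eqxx ?orbT.
have NuD : nbr S u \subset D by rewrite subsetU // subsetUr.
have Nu'D : nbr S u' \subset D by rewrite subsetU // subsetUr orbT.
have /andP[pS up] : (p \in S) && e u p by rewrite -in_nbr.
have /andP[_ u'p] : (p \in S) && e u' p by rewrite -in_nbr.
have common q : q \in nbr S u -> q \in nbr S u' -> q = p.
  rewrite !in_nbr => /andP[qS uq] /andP[_ u'q]; apply/eqP; apply: contraT => qp.
  by exfalso; apply: (noC4 uq _ u'p _ uu' qp); rewrite e_sym.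
have cD : #|D| = 7.
  rewrite cardsU !card_clnbr // du du' (_ : _ :&: _ = [set p]) ?cards1 //.
  apply/setP => q; rewrite in_setI in_set1 !in_clnbr; apply/idP/eqP.
    case/andP => /orP[/eqP->|uq] /orP[/eqP qu'|u'q].
    - by rewrite qu' eqxx in uu'.
    - by move: u'q; rewrite e_sym (negbTE nuu') andbF.
    - by move: uq; rewrite qu' (negbTE nuu') andbF.
    - by apply: common; rewrite in_nbr.
  by move->; rewrite pS up u'p !orbT.
have Nsum w : w \in S -> deg S w = 3 -> p \in nbr S w ->
    \sum_(y in nbr S w | y != p) #|nbr S w :&: nbr S y| +
      #|nbr S w :&: nbr S p| <= 2.
  move=> wS dw pw; have := tri_le_deg e_sym e_irr noC4 S w.
  have := tri_even e_sym e_irr S w; rewrite /tri_at (bigD1 p) //= dw.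
  by move: #|_| (\sum_(y in _ | _) _) => x y; clear; lia.
have deg_side w w' q : w \in S -> w' \in S -> ~~ e w w' -> w != w' ->
    (forall q, q \in nbr S w -> q \in nbr S w' -> q = p) ->
    D = clnbr S w :|: clnbr S w' -> p \in nbr S w -> p \in nbr S w' ->
    q \in nbr S w -> q != p -> deg D q <= 1 + #|nbr S w :&: nbr S q|.
  move=> wS w'S nww' ww' com -> pw pw' qw qp.
  have /andP[_ wp] : (p \in S) && e w p by rewrite -in_nbr.
  have /andP[_ w'p] : (p \in S) && e w' p by rewrite -in_nbr.
  have /andP[qS wq] : (q \in S) && e w q by rewrite -in_nbr.
  have -> : 1 + #|nbr S w :&: nbr S q| = #|w |: (nbr S w :&: nbr S q)|.
    by rewrite cardsU1 !inE e_irr andbF.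
  apply: subset_leq_card; apply/subsetP => y; rewrite in_nbr => /andP[yD qy].
  rewrite in_setU1 in_setI !in_nbr qy; move: yD.
  rewrite in_setU !in_clnbr -!orbA => /or4P[->//|/andP[-> ->]|/eqP yw'|/andP[yS w'y]].
  - by rewrite orbT.
  - case/eqP: qp; apply: com => //.
    by rewrite in_nbr qS e_sym -yw'.
  (* If [q] had a neighbour [y] other than [p] around [w'], then [w, q, y, w', p] would be a
     5-cycle. *)
  - case: (eqVneq y p) => [->|yp]; first by rewrite pS wp orbT.
    exfalso; apply: (noC5 wq qy _ _ (_ : e p w)) => [|||]; rewrite 1?e_sym.
    + exact: w'y.
    + by rewrite e_sym; exact: w'p.
    + exact: wp.
    rewrite /= !inE !negb_or !andbT.
    rewrite (e_neq e_irr wq) ww' (e_neq e_irr wp) (e_neq e_irr qy) qp.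
    rewrite (eq_sym y) (e_neq e_irr w'y) yp (e_neq e_irr w'p) !andbT /=.
    apply/andP; split.
      by apply: contraNneq nww' => ->; rewrite e_sym.
    by apply: contraNneq qp => qw'; rewrite -qw' wq in nww'.
have degp : deg D p <= 2 + #|nbr S u :&: nbr S p| + #|nbr S u' :&: nbr S p|.
  apply: leq_trans (_ : #|[set u; u'] :|: (nbr S u :&: nbr S p)
    :|: (nbr S u' :&: nbr S p)| <= _).
    apply: subset_leq_card; apply/subsetP => y; rewrite in_nbr => /andP[yD py].
    move: yD; rewrite !inE py !andbT.
    by case: (y == u); case: (y == u'); case: (y \in S); case: (e u y); case: (e u' y).
  rewrite -[2]/(1 + 1) -{1}(cards1 u) -(cards1 u').
  apply: leq_trans (leq_card_setU _ _) _; rewrite leq_add2r.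
  apply: leq_trans (leq_card_setU _ _) _; rewrite leq_add2r.
  exact: leq_card_setU.
(* The degrees over [D] sum to at least 3 * 7 = 21, and at most 16 of this stays inside: 3 for each
   centre, 2 for the edges from [p] to the centres, and 4 for each side, where triangles through [p]
   are charged to the sides. *)
have out : 5 <= \sum_(v in D) deg (S :\: D) v.
  have : \sum_(v in D) 3 <= \sum_(v in D) deg S v.
    by apply: leq_sum => v /(subsetP DS)/min_deg.
  rewrite sum_nat_const cD.
  have -> : \sum_(v in D) deg S v =
      \sum_(v in D) deg D v + \sum_(v in D) deg (S :\: D) v.
    by rewrite -big_split; apply: eq_bigr => v _; apply: deg_split.
  suff : \sum_(v in D) deg D v <= 16.
    by move: (\sum_(v in D) deg D v) (\sum_(v in D) deg (S :\: D) v) => x y; clear; lia.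
  have DE : D = [set u] :|: [set u'] :|: [set p] :|: (nbr S u :\ p)
       :|: (nbr S u' :\ p).
    apply/setP => y; rewrite !inE; case: (eqVneq y p) => [->|_] /=.
      by rewrite pS up !orbT.
    by case: (y == u); case: (y == u'); rewrite ?orbT.
  have le_U (A B : {set T}) :
      \sum_(v in A :|: B) deg D v <= \sum_(v in A) deg D v + \sum_(v in B) deg D v.
    rewrite (big_setID A) /=; apply: leq_add.
      by rewrite setIUl setIid (setUidPl _) // subsetIr.
    rewrite setDUl setDv set0U [X in _ <= X](big_setID A) /=.
    exact: leq_addl.
  have -> : \sum_(v in D) deg D v = \sum_(v in [set u] :|: [set u'] :|: [set p]
      :|: (nbr S u :\ p) :|: (nbr S u' :\ p)) deg D v.
    by apply: eq_bigl => y; rewrite {1}DE.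
  have degu : deg D u <= 3 by rewrite -du deg_sub.
  have degu' : deg D u' <= 3 by rewrite -du' deg_sub.
  have side w w' : w \in S -> w' \in S -> ~~ e w w' -> w != w' -> deg S w = 3 ->
    (forall q, q \in nbr S w -> q \in nbr S w' -> q = p) ->
    D = clnbr S w :|: clnbr S w' -> p \in nbr S w -> p \in nbr S w' ->
    \sum_(v in nbr S w :\ p) deg D v + #|nbr S w :&: nbr S p| <= 4.
    move=> wS w'S nww' ww' dw com DE' pw pw'.
    have : \sum_(v in nbr S w :\ p) deg D v <=
        \sum_(v in nbr S w :\ p) (1 + #|nbr S w :&: nbr S v|).
      apply: leq_sum => q; rewrite !inE => /andP[qp qw].
      by apply: (deg_side w w') => //; rewrite inE.
    rewrite big_split sum_nat_const muln1 /=.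
    have : #|nbr S w :\ p| = 2.
      by have := cardsD1 p (nbr S w); rewrite pw -/(deg S w) dw => -[].
    have := Nsum w wS dw pw.
    rewrite (eq_bigl (mem (nbr S w :\ p))) /=; last first.
      by move=> y; rewrite !inE andbC.
move: (\sum_(v in nbr S w :\ p) deg D v) (#|nbr S w :&: nbr S p|) (#|nbr S w :\ p|).
    move: (\sum_(v in nbr S w :\ p) #|nbr S w :&: nbr S v|).
    by move=> x y z t; clear; lia.
  have s1 := side u u' uS u'S nuu' uu' du common erefl pu pu'.
  have s2 : \sum_(v in nbr S u' :\ p) deg D v + #|nbr S u' :&: nbr S p| <= 4.
    apply: (side u' u) => //; rewrite 1?e_sym 1?eq_sym //.
      by move=> q a b; apply: common.
    exact: setUC.
  apply: leq_trans (le_U _ _) _; apply: leq_trans (leq_add (le_U _ _) (leqnn _)) _.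
  apply: leq_trans (leq_add (leq_add (le_U _ _) (leqnn _)) (leqnn _)) _.
  apply: leq_trans
    (leq_add (leq_add (leq_add (le_U _ _) (leqnn _)) (leqnn _)) (leqnn _)) _.
  rewrite !big_set1; move: degu degu' degp s1 s2.
  move: (deg D u) (deg D u') (deg D p) (\sum_(v in nbr S u :\ p) deg D v).
  move: (\sum_(v in nbr S u' :\ p) deg D v) (#|nbr S u :&: nbr S p|).
  by move: (#|nbr S u' :&: nbr S p|); clear; lia.
(* With [out] edges leaving [D], deletion gives 528 + 210 + 6 * out < 756 + 2 * out, which fails
   once out is at least 5. *)
have := @minimal_del_out D [set u; u'] DS.
rewrite cD cards2 uu' /=.
have := K3_le_out DS.
have : \sum_(v in D) 30 <= \sum_(v in D) (12 * deg S v - 3 * tri S v).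
  by apply: leq_sum => v /(subsetP DS)/weight_ge3.
rewrite sum_nat_const cD => W K.
rewrite subUset !sub1set uD u'D => /(_ isT) H.
have : 264 * 2 + 6 * \sum_(v in D) deg (S :\: D) v +
    \sum_(v in D) (12 * deg S v - 3 * tri S v) <
    108 * 7 + 2 * #|K3_verts (S :\: D)|; last first.
  by move: out W K; clear; lia.
apply: H.
- by apply/set0Pn; exists u; rewrite !inE eqxx.
- apply/independentP => x y /set2P[]-> /set2P[]->; rewrite ?e_irr //.
  by rewrite e_sym.
- by move=> x /set2P[]->.
Qed.

(* The closed neighbourhood of u sends six edges outside, which pays for its four
   vertices. *)
Lemma no_bar u v a b : u \in S -> deg S u = 3 ->
  nbr S u = [set v; a; b] -> v != a -> v != b -> e a b ->
  deg S v = 3 -> deg S a = 4 -> deg S b = 4 -> False.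
Proof.
move=> uS du Nu va vb ab dv da db.
have ab' := e_neq e_irr ab.
have nbrP x : x \in [set v; a; b] -> x \in S /\ e u x.
  by rewrite -Nu in_nbr => /andP[].
have [[vS uv] [aS ua] [bS ub]] : [/\ v \in S /\ e u v, a \in S /\ e u a
    & b \in S /\ e u b] by split; apply: nbrP; rewrite !inE eqxx ?orbT.
have cl_sub : clnbr S u \subset S by apply: clnbr_sub.
have clE : clnbr S u = u |: (v |: (a |: [set b])) by rewrite /closed_nbr Nu !setUA.
have [D defD] : exists D, D = clnbr S u by eexists.
rewrite -defD in clE cl_sub.
have sumD (F : T -> nat) : \sum_(x in D) F x = F u + (F v + (F a + F b)).
  rewrite clE !big_setU1 ?big_set1 ?inE ?negb_or ?ab' ?va ?vb //=.
  by rewrite !(e_neq e_irr).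
have nva : e v a = false.
  by apply/negP => eva; apply: (noC4 uv eva ab _ (e_neq e_irr ua) vb); rewrite e_sym.
have nvb : e v b = false.
  apply/negP => evb; apply: (noC4 uv evb _ (_ : e a u) (e_neq e_irr ub) va); by rewrite e_sym.
have outE x d n : x \in S -> deg S x = d -> #|D :&: nbr S x| = n ->
    deg (S :\: D) x = d - n.
  by move=> xS <- <-; rewrite (deg_split e x cl_sub) -deg_cap // addKn.
have inD y : (y \in D) = [|| y == u, y == v, y == a | y == b].
  by rewrite clE !inE.
have outv : deg (S :\: D) v = 2.
  rewrite (@outE v 3 1) // (_ : _ :&: _ = [set u]) ?cards1 //.
  apply/setP => y; rewrite in_setI in_nbr inD in_set1.
  by case: eqVneq => [->|_] /=; [rewrite uS e_sym|apply/negP => /andP[/or3P[]/eqP->]];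
    rewrite ?e_irr ?nva ?nvb ?andbF.
have outa : deg (S :\: D) a = 2.
  rewrite (@outE a 4 2) // (_ : _ :&: _ = [set u; b]) ?cards2 ?(e_neq e_irr ub) //.
  apply/setP => y; rewrite in_setI in_nbr inD !inE.
  case: eqVneq => [->|_] /=; first by rewrite uS e_sym.
  rewrite !orbA orbC; case: eqVneq => [->|_] /=; first by rewrite bS ab.
  by apply/negP => /andP[/orP[]/eqP->]; rewrite ?e_irr 1?e_sym ?nva ?andbF.
have outb : deg (S :\: D) b = 2.
  rewrite (@outE b 4 2) // (_ : _ :&: _ = [set u; a]) ?cards2 ?(e_neq e_irr ua) //.
  apply/setP => y; rewrite in_setI in_nbr inD !inE.
  case: eqVneq => [->|_] /=; first by rewrite uS e_sym.
  rewrite orbCA; case: eqVneq => [->|_] /=; first by rewrite aS e_sym.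
  by apply/negP => /andP[/orP[]/eqP->]; rewrite ?e_irr 1?e_sym ?nvb ?andbF.
(* Each vertex of a triangle component of the rest has a neighbour among [v], [a], [b]. Two
   different such neighbours close a 5-cycle through [u]; a single common one closes a 4-cycle with
   the triangle. *)
have K0 : K3_verts (S :\: D) = set0.
  apply/eqP; apply: contraT => /set0Pn[x]; rewrite inE => /and3P[xR cx /forall_inP allx].
  have toD y : y \in clnbr (S :\: D) x -> exists2 c, c \in [set v; a; b] & e y c.
    move=> yx; have yR : y \in S :\: D.
      by move: yx; rewrite in_clnbr => /orP[/eqP->|/andP[]].
    have [yS yD] : y \in S /\ y \notin D by move: yR; rewrite inE => /andP[].
    have : 0 < deg D y.
      have := min_deg yS; rewrite (deg_split e y cl_sub).
      have := card_clnbr e_irr (S :\: D) y; rewrite (eqP (allx y yx)) (eqP cx).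
      by move: (deg D y) (deg _ y); clear; lia.
    rewrite card_gt0 => /set0Pn[c]; rewrite in_nbr => /andP[cD yc].
    exists c => //; move: cD; rewrite inD !inE -!orbA => /orP[/eqP cu|//].
    by case/negP: yD; rewrite defD in_clnbr yS e_sym -cu yc orbT.
  have /card_gt1P[y [z [yN zN yz]]] : 1 < #|nbr (S :\: D) x|.
    by have := card_clnbr e_irr (S :\: D) x; rewrite (eqP cx) /degree => -[<-].
  have yx : y \in clnbr (S :\: D) x by rewrite inE yN orbT.
  have zx : z \in clnbr (S :\: D) x by rewrite inE zN orbT.
  have xx : x \in clnbr (S :\: D) x by rewrite !inE eqxx.
  have exy : e x y by move: yN; rewrite in_nbr => /andP[].
  have exz : e x z by move: zN; rewrite in_nbr => /andP[].
  have eyz : e y z.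
    have := zx; rewrite -(eqP (allx y yx)) in_clnbr eq_sym (negbTE yz) /=.
    by case/andP.
  have notD w : w \in clnbr (S :\: D) x -> w \notin D.
    rewrite in_clnbr => /orP[/eqP->|/andP[]]; last by rewrite inE => /andP[].
    by move: xR; rewrite inE => /andP[].
  have same p q c c' : p \in clnbr (S :\: D) x -> q \in clnbr (S :\: D) x ->
      e p q -> c \in [set v; a; b] -> c' \in [set v; a; b] -> e p c -> e q c' -> c = c'.
    move=> px qx pq cN c'N pc qc'; apply/eqP; apply: contraT => cc'; exfalso.
    have [[cS uc] [c'S uc']] := (nbrP c cN, nbrP c' c'N).
    have cD : c \in D by rewrite defD in_clnbr cS uc orbT.
    have c'D : c' \in D by rewrite defD in_clnbr c'S uc' orbT.
    have uD : u \in D by rewrite defD in_clnbr eqxx.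
    apply: (noC5 pq qc' (_ : e c' u) uc); rewrite 1?e_sym //.
    have nd w w' : w \in clnbr (S :\: D) x -> w' \in D -> w != w'.
      by move=> /notD wD w'D; apply: contraNneq wD => ->.
    rewrite /= !inE !negb_or (e_neq e_irr pq) !(nd p) // !(nd q) //.
    by rewrite (eq_sym c' u) (eq_sym c' c) cc' !(e_neq e_irr).
  have [cx' cxN ecx] := toD x xx; have [cy cyN ecy] := toD y yx.
  have [cz czN ecz] := toD z zx.
  have E1 := same x y _ _ xx yx exy cxN cyN ecx ecy.
  have E2 := same x z _ _ xx zx exz cxN czN ecx ecz.
  rewrite -E1 in ecy; rewrite -E2 e_sym in ecz; rewrite e_sym in exz.
  by case: (noC4 exy ecy ecz exz (e_neq e_irr ecx) yz).
have uD : u \in D by rewrite inD eqxx.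
have := @minimal_del_out D [set u] cl_sub.
rewrite sub1set uD !sumD outv outa outb K0 cards0 cards1 defD card_clnbr // du.
have -> : [set u] != set0 by apply/set0Pn; exists u; rewrite set11.
move=> /(_ isT isT (independent1 u)) H.
have {}H := H (fun x => ltac:(by move=> /set1P->; apply: subsetUr)).
(* The balance is exact: 264 + 6 * 6 + 30 + 30 + 36 + 36 = 108 * 4. *)
have wu := weight_ge3 uS; have wv := weight_ge3 vS.
have [_ _ _ _ wa] := weight_ge e_sym e_irr noC4 S a.
have [_ _ _ _ wb] := weight_ge e_sym e_irr noC4 S b.
rewrite da in wa; rewrite db in wb; rewrite du in wu.
move: H wu wv (wa isT) (wb isT); rewrite da db; do 4!move: (_ - _); clear; lia.
Qed.

(** * Discharging: matching bad vertices with good ones *)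

Hypothesis sparse : \sum_(v in S) 4 * deg S v < 12 * #|S| + \sum_(v in S) tri S v.

(* bad and good mean w(v) = -1 and w(v) >= 1; recall that tri_at is even. *)
Let bad v := (deg S v == 3) && (0 < tri S v).
Let good v := 4 * deg S v >= tri S v + 14.

(* The helper h of a bad vertex v is its neighbour outside the triangle at v.  If
   that neighbour c has degree 3, then h is a further neighbour of c when c is in
   no triangle, and otherwise a vertex of degree at least 5 in the triangle at v. *)
Let helps h v := [&& good h, h \in S &
  (e v h && [forall b in nbr S v :&: nbr S h, deg S b != 3]) ||
  [exists c in S, [&& e c v, e c h, deg S c == 3, tri S c == 0 & v != h]]].

Lemma tri_eq0 v x y : tri S v = 0 -> x \in nbr S v -> y \in nbr S v -> e x y = false.
Proof.
move=> /eqP t0 xv yv; apply/negP => xy; move: t0; rewrite sum_nat_eq0.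
move=> /forall_inP/(_ x xv); rewrite cards_eq0 => /eqP/setP/(_ y).
by move: yv; rewrite !inE xy => /andP[-> ->].
Qed.

(** An edge at [v] in no triangle makes [tri_at] smaller than the degree; in the tightest case,
    degree 4, parity leaves at most 2, and 16 = 2 + 14. *)
Lemma good_nontri v c : v \in S -> c \in nbr S v -> nbr S v :&: nbr S c = set0 ->
  3 < deg S v -> good v.
Proof.
move=> vS cv c0; have := tri_lt_deg e_sym e_irr noC4 cv c0.
have := tri_even e_sym e_irr S v; rewrite /good; move: (deg S v) (tri S v).
clear; lia.
Qed.

(** A shared helper yields two vertices of degree 3 with a common neighbour, adjacent by [no_close].
    The resulting triangle either puts a vertex of degree 3 among the common neighbours of [v] and
    [h], or contains an intermediate vertex [c] assumed to lie in no triangle. *)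
Lemma helps_inj v v' h : v \in S -> v' \in S -> bad v -> bad v' ->
  helps h v -> helps h v' -> v = v'.
Proof.
move=> vS v'S /andP[/eqP dv tv] /andP[/eqP dv' tv'] /and3P[_ hS Hv] /and3P[_ _ Hv'].
have mix x y : x \in S -> y \in S -> deg S x = 3 -> 0 < tri S x -> 
    (e x h && [forall b in nbr S x :&: nbr S h, deg S b != 3]) ->
    [exists c in S, [&& e c y, e c h, deg S c == 3, tri S c == 0 & y != h]] -> False.
  move=> xS yS dx tx /andP[xh _] /exists_inP[c cS /and5P[cy ch /eqP dc /eqP tc _]].
  have xc : x != c by apply: contraTneq tx => ->; rewrite tc.
  have exc : e x c.
    by apply: (@no_close x c h) => //; rewrite in_nbr hS.
  have : e x h = false by apply: (tri_eq0 tc); rewrite in_nbr ?xS ?hS // e_sym.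
  by rewrite xh.
apply/eqP; apply: contraT => vv'; exfalso.
case/orP: Hv => Hv; case/orP: Hv' => Hv'.
- case/andP: Hv => vh /forall_inP/(_ v'); case/andP: Hv' => v'h _.
  have evv' : e v v' by apply: (@no_close v v' h) => //; rewrite in_nbr hS.
  by rewrite dv' eqxx in_setI !in_nbr v'S evv' e_sym v'h => /(_ isT).
- exact: (mix v v').
- exact: (mix v' v).
case/exists_inP: Hv => c cS /and5P[cv ch /eqP dc /eqP tc _].
case/exists_inP: Hv' => c' c'S /and5P[c'v' c'h /eqP dc' /eqP tc' _].
case: (eqVneq c c') => [cc'|cc'].
  subst c'; have evv' : e v v'.
    by apply: (@no_close v v' c) => //; rewrite in_nbr cS e_sym.
  suff : e v v' = false by rewrite evv'.
  by apply: (tri_eq0 tc); rewrite in_nbr ?vS ?v'S.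
have ecc' : e c c' by apply: (@no_close c c' h) => //; rewrite in_nbr hS.
have : e c' h = false by apply: (tri_eq0 tc); rewrite in_nbr ?hS ?c'S.
by rewrite c'h.
Qed.

Lemma cards3P (A : {set T}) c : #|A| = 3 -> c \in A ->
  exists a b, [/\ A = [set c; a; b], a != b, c != a & c != b].
Proof.
move=> A3 cA; have : #|A :\ c| == 2 by have := cardsD1 c A; rewrite cA A3 add1n => -[<-].
case/cards2P => a [b [ab Aab]]; exists a, b.
have : a \in A :\ c by rewrite Aab !inE eqxx.
have : b \in A :\ c by rewrite Aab !inE eqxx orbT.
rewrite !inE => /andP[bc _] /andP[ac _]; split=> //; [|by rewrite eq_sym|by rewrite eq_sym].
by rewrite -(setD1K cA) Aab setUA.
Qed.

Lemma bad_helped v : v \in S -> bad v -> exists h, helps h v.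
Proof.
move=> vS /andP[/eqP dv tv].
have [a0 [b0 [a0v b0v ab0]]] : exists a b, [/\ a \in nbr S v, b \in nbr S v & e a b].
  move: tv; rewrite lt0n sum_nat_eq0 negb_forall_in => /exists_inP[a av].
  rewrite -lt0n card_gt0 => /set0Pn[b]; rewrite in_setI => /andP[bv].
  by rewrite in_nbr => /andP[_ ab]; exists a, b.
have [a1 [b1 [Nv1 ab1 ab2 ab3]]] := cards3P dv a0v.
have [c [a [b [Nv eab ca cb]]]] : exists c a b,
    [/\ nbr S v = [set c; a; b], e a b, c != a & c != b].
  have : b0 \in [set a0; a1; b1] by rewrite -Nv1.
  rewrite !inE -orbA => /or3P[]/eqP E; rewrite E in ab0.
  - by rewrite e_irr in ab0.
  - exists b1, a0, a1; rewrite [b1 == a0]eq_sym [b1 == a1]eq_sym; split=> //.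
    by rewrite Nv1; apply/setP => x; rewrite !inE; do 3!case: (x == _).
  - exists a1, a0, b1; rewrite [a1 == a0]eq_sym; split=> //.
    by rewrite Nv1; apply/setP => x; rewrite !inE; do 3!case: (x == _).
have Nvx x : x \in [set c; a; b] -> x \in S /\ e v x.
  by rewrite -Nv in_nbr => /andP[].
have [[cS vc] [aS va] [bS vb]] : [/\ c \in S /\ e v c, a \in S /\ e v a
    & b \in S /\ e v b] by split; apply: Nvx; rewrite !inE eqxx ?orbT.
have ab := e_neq e_irr eab.
have nca : e c a = false.
  by apply/negP => eca; apply: (noC4 vc eca eab _ (e_neq e_irr va) cb); rewrite e_sym.
have ncb : e c b = false.
  by apply/negP => ecb; apply: (noC4 vc ecb (_ : e b a) _ (e_neq e_irr vb) ca);
    rewrite e_sym.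
have cv0 : nbr S c :&: nbr S v = set0.
  apply/setP => x; rewrite in_setI Nv in_set0 in_nbr !inE -!orbA.
  by apply/negP => /andP[/andP[_ cx]] /or3P[]/eqP E; move: cx;
    rewrite E ?e_irr ?nca ?ncb.
have vNc : v \in nbr S c by rewrite in_nbr vS e_sym.
(* The edge [vc] lies in no triangle, so [c] is good as soon as its degree is at least 4. *)
case: (ltnP 3 (deg S c)) => [c4|c3].
  exists c; rewrite /helps cS (good_nontri cS vNc cv0 c4) vc /=.
  apply/orP; left; apply/forall_inP => x.
  by rewrite setIC cv0 inE.
have {c3}dc : deg S c = 3 by apply/eqP; rewrite eqn_leq c3 min_deg.
(* When [c] has degree 3 and lies in a triangle, [no_close] through [v] gives [a] and [b] degree at
   least 4, and [no_bar] excludes that both have degree exactly 4. *)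
case: (posnP (tri S c)) => [tc|tc]; last first.
  have deg4 x : x \in S -> e v x -> e c x = false -> c != x -> 3 < deg S x.
    move=> xS vx ncx cx; rewrite ltn_neqAle min_deg // andbT.
    apply/eqP => /esym dx; suff : e c x by rewrite ncx.
    by apply: (@no_close c x v) => //; rewrite in_nbr vS e_sym.
  have a4 := deg4 a aS va nca ca; have b4 := deg4 b bS vb ncb cb.
  have help5 x y : x \in S -> e v x -> nbr S v :&: nbr S x \subset [set y] ->
      3 < deg S y -> 4 < deg S x -> exists h, helps h v.
    move=> xS vx sub y4 x5; exists x; rewrite /helps xS vx /= /good.
    have -> /= : tri S x + 14 <= 4 * deg S x.
      have := tri_le_deg e_sym e_irr noC4 S x; move: x5 (tri S x); clear; lia.
    apply/orP; left; apply/forall_inP => z /(subsetP sub)/set1P->.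
    by rewrite neq_ltn y4 orbT.
  case: (ltnP 4 (deg S a)) => [a5|a5].
    apply: (help5 a b) => //; apply/subsetP => z; rewrite in_setI Nv !inE -!orbA.
    by case/andP => /or3P[]/eqP-> //; rewrite 1?e_sym ?nca ?e_irr ?andbF.
  case: (ltnP 4 (deg S b)) => [b5|b5].
    apply: (help5 b a) => //; apply/subsetP => z; rewrite in_setI Nv !inE -!orbA.
    by case/andP => /or3P[]/eqP-> //; rewrite 1?e_sym ?ncb ?e_irr ?andbF.
  by case: (@no_bar v c a b) => //; apply/eqP; rewrite eqn_leq ?a4 ?b4 ?a5 ?b5.
(* When [c] lies in no triangle, another neighbour [p] of [c] helps: it is not adjacent to [v], so
   [no_close] through [c] excludes degree 3. *)
have [p [q [Nc pq vp vq]]] := cards3P dc vNc.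
have /andP[pS cp] : (p \in S) && e c p by rewrite -in_nbr Nc !inE eqxx ?orbT.
have Np0 : nbr S p :&: nbr S c = set0.
  apply/setP => x; rewrite in_setI in_set0; apply/negP => /andP[].
  rewrite in_nbr => /andP[_ px] xc; suff : e p x = false by rewrite px.
  by apply: (tri_eq0 tc) => //; rewrite in_nbr pS.
have nvp : e v p = false.
  by apply: (tri_eq0 tc); rewrite in_nbr ?vS ?pS // e_sym.
have p4 : 3 < deg S p.
  rewrite ltn_neqAle min_deg // andbT; apply/eqP => /esym dp.
  suff : e v p by rewrite nvp.
  by apply: (@no_close v p c) => //; rewrite in_nbr cS // e_sym.
have cNp : c \in nbr S p by rewrite in_nbr cS e_sym.
exists p; rewrite /helps pS (good_nontri pS cNp Np0 p4) /=.
apply/orP; right; apply/exists_inP; exists c => //.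
by rewrite cp dc tc vp e_sym vc.
Qed.

Lemma no_minimal : False.
Proof.
(* The default [v] is never taken at a bad vertex, where a helper exists. *)
pose f v := odflt v [pick h | helps h v].
have fP v : v \in S -> bad v -> helps (f v) v.
  move=> vS /(bad_helped vS)[h hv]; rewrite /f; case: pickP => //= /(_ h).
  by rewrite hv.
have le : #|[set v in S | bad v]| <= #|[set v in S | good v]|.
  rewrite -(card_in_imset (f := f)).
    apply: subset_leq_card; apply/subsetP => h /imsetP[v]; rewrite !inE.
    by move=> /andP[vS bv] ->; have /and3P[-> -> _] := fP v vS bv.
  move=> v v'; rewrite !inE => /andP[vS bv] /andP[v'S bv'] E.
  by apply: (@helps_inj v v' (f v)) => //; [exact: fP | rewrite E; exact: fP].
(* Termwise this says that twice the weight is at least 2 at a good vertex, at least -2 at a bad one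
   and nonnegative elsewhere. *)
have : \sum_(v in S) (tri S v + 12 + 2 * good v) <=
    \sum_(v in S) (4 * deg S v + 2 * bad v).
  apply: leq_sum => v vS; have := min_deg vS; rewrite /bad /good.
  have := tri_le_deg e_sym e_irr noC4 S v; have := tri_even e_sym e_irr S v.
  by move: (deg S v) (tri S v); clear; lia.
rewrite [X in X <= _]big_split [X in X + _ <= _]big_split [X in _ <= X]big_split /=.
rewrite -!big_distrr sum_nat_const /=.
have E (P : pred T) : #|[set v in S | P v]| = \sum_(v in S) P v.
  rewrite -sum1_card big_mkcond [RHS]big_mkcond; apply: eq_bigr => v _.
  by rewrite inE; case: (v \in S); case: (P v).
move: le sparse; rewrite !E -big_distrr /=.
move: (\sum_(v in S) good v) (\sum_(v in S) bad v) (\sum_(v in S) deg S v).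
move: (\sum_(v in S) tri S v) #|S|; clear; lia.
Qed.
End Minimal.

(** * From the potential to large independent sets *)

Lemma independent_large (T : finType) (e : rel T) :
  symmetric e -> irreflexive e -> C4_free e -> C5_free e ->
  (forall S : {set T}, S != set0 -> \sum_(v in S) 4 * degree e S v <
    12 * #|S| + \sum_(v in S) tri_at e S v) ->
  forall S : {set T}, exists I : {set T},
    [/\ I \subset S, independent e I & 3 * #|S| <= 11 * #|I|].
Proof.
move=> e_sym e_irr noC4 noC5 sparse.
have pot (S : {set T}) : potential_bound e S.
  have [n] := ubnP #|S|; elim: n S => // n IHn S lt_n.
  apply: contrapT => notS.
  have IH (R : {set T}) : R \proper S -> potential_bound e R.
    by move=> /proper_card RS; apply: IHn; apply: leq_trans RS _.
  have S0 : S != set0.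
    apply: contra_notN notS => /eqP->; exists set0.
    by rewrite !big_set0 cards0 sub0set; split=> //; apply/independentP => x y; rewrite inE.
  exact: (no_minimal e_sym e_irr noC4 noC5 IH notS (sparse S S0)).
move=> S; have [n] := ubnP #|S|; elim: n S => // n IHn S lt_n.
have [K0|/set0Pn[v vK]] := eqVneq (K3_vertices e S) set0.
  have [->|S0] := eqVneq S set0.
    exists set0; rewrite sub0set !cards0; split=> //.
    by apply/independentP => x y; rewrite inE.
  (* Three times the sparsity inequality cancels the degree and triangle sums and leaves 264 |I| >
     72 |S|, that is 11 |I| > 3 |S|. *)
  have [I [IS indI HI]] := pot S; exists I; split=> //.
  move: HI (sparse S S0); rewrite K0 cards0 -big_distrr /=.
  move: #|I| #|S| (\sum_(v in S) degree e S v) (\sum_(v in S) tri_at e S v).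
  clear; lia.
(* A triangle component contributes one vertex out of three, which is better than 3 out of 11. *)
move: vK; rewrite inE => /and3P[vS /eqP c3 /forall_inP allv].
have cS := clnbr_sub e vS.
have cR : #|S| = 3 + #|S :\: closed_nbr e S v|.
  by rewrite -c3 -[in LHS](cardsID (closed_nbr e S v) S) (setIidPr cS).
have [|I [IR /independentP indI HI]] := IHn (S :\: closed_nbr e S v).
  by move: lt_n; rewrite cR; move: #|_|; clear; lia.
have vI : v \notin I.
  by apply/negP => /(subsetP IR); rewrite !inE eqxx.
have sep y : y \in I -> ~~ e v y.
  by move/(subsetP IR); rewrite in_setD in_clnbr negb_or; case: (e v y) => //;
    rewrite andbT => /andP[/andP[_ /negbTE->]].
exists (v |: I); split.
- by rewrite subUset sub1set vS (subset_trans IR) ?subsetDl.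
- apply/independentP => x y /setU1P[->|xI] /setU1P[->|yI].
  + by rewrite e_irr.
  + exact: sep.
  + by rewrite e_sym; apply: sep.
  + exact: indI.
rewrite cR cardsU1 vI; move: HI; move: #|_| #|I|; clear; lia.
Qed.

(** * Even edge sets *)

Section Even.
Variables (T : finType) (e : rel T).
Hypotheses (e_sym : symmetric e) (e_irr : irreflexive e).
Hypotheses (noC4 : C4_free e) (noC5 : C5_free e).

Definition edges (S : {set T}) : {set {set T}} :=
  [set A : {set T} | [exists x in S, exists y in S, e x y && (A == [set x; y])]].
Definition triangles (S : {set T}) : {set {set T}} :=
  [set V : {set T} | [&& V \subset S, #|V| == 3 &
    [forall x in V, forall y in V, (x != y) ==> e x y]]].
Definition pairs (V : {set T}) : {set {set T}} :=
  [set A : {set T} | (A \subset V) && (#|A| == 2)].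

Lemma edgesP (S A : {set T}) : reflect
  (exists x y, [/\ x \in S, y \in S, e x y & A = [set x; y]]) (A \in edges S).
Proof.
rewrite inE; apply: (iffP exists_inP) => [[x xS /exists_inP[y yS /andP[xy /eqP]]]|].
  by exists x, y.
move=> [x [y [xS yS xy ->]]]; exists x => //; apply/exists_inP; exists y => //.
by rewrite xy eqxx.
Qed.

(** For sets of edges these are the elements of the cycle space over the field with two elements. *)
Definition even_set (X : {set {set T}}) :=
  forall v, ~~ odd #|[set A in X | v \in A]|.

Lemma set2_inj (x y z : T) : [set x; y] = [set x; z] -> y = z.
Proof.
move=> E; have : y \in [set x; z] by rewrite -E !inE eqxx orbT.
have : z \in [set x; y] by rewrite E !inE eqxx orbT.
by rewrite !inE => /orP[]/eqP-> // /orP[]/eqP->.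
Qed.

Section EvenSet.
Variables (S : {set T}) (X : {set {set T}}).
Hypotheses (XS : X \subset edges S) (Xeven : even_set X).

Lemma even_edge x y : [set x; y] \in X -> [/\ x \in S, y \in S & e x y].
Proof.
move/(subsetP XS)/edgesP => [a [b [aS bS ab /setP E]]].
have xab := E x; have yab := E y; have aE := E a; have bE := E b.
move: xab yab aE bE; rewrite !inE !eqxx !orbT /= => /esym xab /esym yab aE bE.
have nab := e_neq e_irr ab.
case/orP: xab => /eqP xa; case/orP: yab => /eqP yb; subst x y; split=> //.
- by move: bE; rewrite orbb eq_sym (negbTE nab).
- by rewrite e_sym.
- by move: aE; rewrite orbb (negbTE nab).
Qed.

Lemma even_next x y : [set x; y] \in X ->
  exists z, [/\ [set y; z] \in X, z != x & e y z].
Proof.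
move=> xyX; have := Xeven y.
rewrite (cardsD1 [set x; y]) !inE xyX eqxx orbT add1n /= negbK.
case: (set_0Vmem ([set A in X | y \in A] :\ [set x; y])) => [->|[A]].
  by rewrite cards0.
rewrite !inE => /and3P[Axy AX yA] _.
have /edgesP[a [b [aS bS ab E]]] := subsetP XS A AX; subst A.
move: yA; rewrite !inE => /orP[]/eqP E; subst y.
  exists b; split=> //; apply: contraNneq Axy => ->.
  by rewrite setUC eqxx.
exists a; rewrite setUC e_sym; split=> //; apply: contraNneq Axy => ->.
by rewrite eqxx.
Qed.

Lemma pairs3 x y z : x != y -> y != z -> z != x ->
  pairs [set x; y; z] = [set [set x; y]; [set y; z]; [set z; x]].
Proof.
move=> xy yz zx; apply/setP => A; rewrite 3!inE; apply/andP/idP.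
  case=> /subsetP sub /cards2P[a [b [ab E]]]; subst A.
  have : a \in [set x; y; z] by apply: sub; rewrite !inE eqxx.
  have : b \in [set x; y; z] by apply: sub; rewrite !inE eqxx orbT.
  rewrite !inE -!orbA => /or3P[]/eqP E1 /or3P[]/eqP E2; subst a b;
    rewrite ?eqxx ?orbT //; try (by rewrite eqxx in ab).
  - by rewrite [[set y; x]]setUC eqxx.
  - by rewrite [[set z; y]]setUC eqxx !orbT.
  - by rewrite [[set x; z]]setUC eqxx !orbT.
rewrite !inE -!orbA => /or3P[]/eqP->; split; rewrite ?cards2 ?xy ?yz ?zx //;
  by apply/subsetP => w; rewrite !inE => /orP[]->; rewrite ?orbT.
Qed.

(** Follow a walk [a, b, c, d, f, g, h] in [X] without turning back, using [even_next]. A return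
    after three steps is a triangle, after four or five steps a forbidden cycle; otherwise the six
    edges walked are distinct. *)
Lemma even_card_ge : X != set0 ->
  (exists2 V, V \in triangles S & pairs V \subset X) \/ 6 <= #|X|.
Proof.
have tri x y z : [set x; y] \in X -> [set y; z] \in X -> [set z; x] \in X ->
    exists2 V, V \in triangles S & pairs V \subset X.
  move=> xy yz zx.
  have [xS yS exy] := even_edge xy; have [_ zS eyz] := even_edge yz.
  have [_ _ ezx] := even_edge zx.
  have [nxy nyz nzx] : [/\ x != y, y != z & z != x] by rewrite !(e_neq e_irr).
  exists [set x; y; z]; last first.
    by rewrite pairs3 //; apply/subsetP => A; rewrite !inE -orbA
      => /or3P[]/eqP->.
  rewrite inE; apply/and3P; split.
  - by apply/subsetP => w; rewrite !inE -orbA => /or3P[]/eqP->.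
  - by rewrite setUC cardsU1 !inE negb_or nzx (eq_sym z) nyz cards2 nxy.
  apply/forall_inP => a; rewrite !inE -orbA => /or3P[]/eqP-> /=;
  apply/forall_inP => b; rewrite !inE -orbA => /or3P[]/eqP-> /=;
  by rewrite ?eqxx ?exy ?eyz ?ezx ?implybT // e_sym ?exy ?eyz ?ezx ?implybT.
case/set0Pn => A AX; have /edgesP[a [b [aS bS ab E]]] := subsetP XS A AX; subst A.
have [c [bcX ca ebc]] := even_next AX.
have [d [cdX db ecd]] := even_next bcX.
have [da|da] := eqVneq d a; first by left; apply: (tri a b c) => //; rewrite -da.
have [f [dfX fc edf]] := even_next cdX.
have [fb|fb] := eqVneq f b; first by left; apply: (tri b c d) => //; rewrite -fb.
have [fa|fa] := eqVneq f a.
  exfalso; rewrite fa in edf; rewrite eq_sym in db.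
  by apply: (noC4 ab ebc ecd edf _ db); rewrite eq_sym.
have [g [fgX gd efg]] := even_next dfX.
have [gc|gc] := eqVneq g c; first by left; apply: (tri c d f) => //; rewrite -gc.
have [gb|gb] := eqVneq g b.
  exfalso; rewrite gb in efg; rewrite eq_sym in fc.
  by apply: (noC4 ebc ecd edf efg _ fc); rewrite eq_sym.
have [ga|ga] := eqVneq g a.
  exfalso; rewrite ga in efg; apply: (noC5 ab ebc ecd edf efg).
  rewrite /= !inE !negb_or (e_neq e_irr ab) (eq_sym a) ca (eq_sym a) da.
  rewrite (eq_sym a) fa (e_neq e_irr ebc) (eq_sym b) db (eq_sym b) fb.
  by rewrite (e_neq e_irr ecd) (eq_sym c) fc (e_neq e_irr edf).
have [h [ghX hf egh]] := even_next fgX.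
right; have nab := e_neq e_irr ab; have nbc := e_neq e_irr ebc.
have ncd := e_neq e_irr ecd; have ndf := e_neq e_irr edf.
have nfg := e_neq e_irr efg; have ngh := e_neq e_irr egh.
pose s := [:: [set a; b]; [set b; c]; [set c; d]; [set d; f]; [set f; g]; [set g; h]].
have us : uniq s.
  have neq (p q u w : T) : (p \notin [set u; w]) -> [set p; q] != [set u; w].
    by move=> H; apply: contraNneq H => <-; rewrite !inE eqxx.
  have neq' (p q u w : T) : (p \notin [set u; w]) -> [set u; w] != [set p; q].
    by rewrite eq_sym; apply: neq.
  rewrite /s /= !inE !negb_or.
  have [[ac ad af ag] [bd bf bg] [cf cg dg]] :
    [/\ [/\ a != c, a != d, a != f & a != g], [/\ b != d, b != f & b != g]
      & [/\ c != f, c != g & d != g]] by split; split; rewrite // eq_sym.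
  rewrite (neq f g) ?(neq' g h) ?(neq a b) ?(neq b c) ?(neq c d) ?(neq d f) //
    !inE negb_or ?nab ?ac ?ad ?af ?ag ?nbc ?bd ?bf ?bg ?ncd ?cf ?cg ?ndf ?dg ?nfg
    ?(eq_sym f) ?hf // !(eq_sym g) ?ag ?bg ?cg ?dg ?nfg //.
apply: (@leq_trans (size s)) => //; rewrite cardE; apply: uniq_leq_size => // A.
by rewrite !inE mem_enum => /or4P[|||/or3P[]]/eqP->.
Qed.
End EvenSet.

Lemma even_setD (X Y : {set {set T}}) : Y \subset X -> even_set X -> even_set Y ->
  even_set (X :\: Y).
Proof.
move=> YX eX eY v; have := eX v; have := eY v.
have -> : #|[set A in X | v \in A]| =
    #|[set A in Y | v \in A]| + #|[set A in X :\: Y | v \in A]|.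
  rewrite -(cardsID Y [set A in X | v \in A]); congr addn; apply: eq_card => A.
    rewrite !inE; case: (boolP (A \in Y)) => [/(subsetP YX) ->|]; rewrite ?andbT //.
    by rewrite andbF.
  by rewrite !inE andbA.
by rewrite oddD; do 2!case: odd.
Qed.

Lemma even_pairs (S V : {set T}) : V \in triangles S -> even_set (pairs V).
Proof.
rewrite inE => /and3P[_ /eqP V3 _] v.
case: (boolP (v \in V)) => [vV|vV]; last first.
  rewrite (_ : [set A in pairs V | v \in A] = set0) ?cards0 //.
  apply/setP => A; rewrite !inE; apply/negP => /andP[/andP[/subsetP sub _] /sub].
  by apply/negP.
have -> : [set A in pairs V | v \in A] = [set [set v; w] | w in V :\ v].
  apply/setP => A; rewrite !inE; apply/andP/imsetP.
    case=> /andP[/subsetP sub /cards2P[a [b [ab E]]]]; subst A.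
    rewrite !inE => /orP[]/eqP E; subst v.
      exists b => //; rewrite !inE eq_sym ab sub // !inE eqxx orbT //.
    exists a; last by rewrite setUC.
    by rewrite !inE ab sub // !inE eqxx.
  case=> w; rewrite !inE => /andP[wv wV] ->; split; last by rewrite !inE eqxx.
  by rewrite cards2 (eq_sym v) wv subUset !sub1set vV wV.
rewrite card_imset; last by move=> x y /set2_inj.
by have := cardsD1 v V; rewrite vV V3 add1n => -[<-].
Qed.

Lemma card_pairs (S V : {set T}) : V \in triangles S -> #|pairs V| = 3.
Proof.
rewrite inE => /and3P[_ /eqP V3 _]; rewrite /pairs.
by rewrite cards_draws V3.
Qed.

(** If [X] properly contains a triangle, the remainder is again even and nonempty, so it has at
    least 3 further edges. *)
Lemma even_set_card (S : {set T}) (X : {set {set T}}) : X \subset edges S ->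
  even_set X -> X != set0 ->
  (exists2 V, V \in triangles S & X = pairs V) \/ 6 <= #|X|.
Proof.
move=> XS eX X0; case: (even_card_ge XS eX X0) => [[V VS PX]|]; last by right.
have [->|ne] := eqVneq X (pairs V); [by left; exists V | right].
have D0 : X :\: pairs V != set0.
  by apply: contraNneq ne => /eqP; rewrite setD_eq0 => XP; rewrite eqEsubset XP PX.
have DS : X :\: pairs V \subset edges S by rewrite (subset_trans _ XS) ?subsetDl.
have := even_card_ge DS (even_setD PX eX (even_pairs VS)) D0.
have := cardsD X (pairs V); rewrite (setIidPr PX) (card_pairs VS).
move=> cD [[W WS /subset_leq_card]|]; last first.
  by move/leq_trans; apply; apply: subset_leq_card; apply: subsetDl.
rewrite (card_pairs WS) cD; lia.
Qed.

Lemma degE (S : {set T}) v : v \in S ->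
  #|[set A in edges S | v \in A]| = degree e S v.
Proof.
move=> vS; rewrite /degree -(card_imset (f := fun w => [set v; w])); last first.
  by move=> x y /set2_inj.
apply: eq_card => A; rewrite inE; apply/andP/imsetP.
  case=> /edgesP[a [b [aS bS ab E]]]; subst A; rewrite !inE => /orP[]/eqP E; subst v.
    by exists b => //; rewrite in_nbr bS.
  by exists a; [rewrite in_nbr aS e_sym | rewrite setUC].
case=> w; rewrite in_nbr => /andP[wS vw] ->; split; last by rewrite !inE eqxx.
by apply/edgesP; exists v, w.
Qed.

Lemma sum_card_mem (P : {set {set T}}) (S : {set T}) :
  (forall A, A \in P -> A \subset S) ->
  \sum_(v in S) #|[set A in P | v \in A]| = \sum_(A in P) #|A|.
Proof.
move=> PS; under eq_bigr do rewrite -sum1_card.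
under [RHS]eq_bigr do rewrite -sum1_card.
rewrite (exchange_big_dep (mem P)) /=; last by move=> v A _; rewrite inE => /andP[].
apply: eq_bigr => A AP; apply: eq_bigl => v; rewrite inE AP /=.
by apply: andb_idl; apply: (subsetP (PS A AP)).
Qed.

Lemma handshake (S : {set T}) : \sum_(v in S) degree e S v = 2 * #|edges S|.
Proof.
rewrite -(eq_bigr _ (fun v vS => degE vS)) sum_card_mem.
  rewrite mulnC -sum_nat_const; apply: eq_bigr => A /edgesP[x [y [_ _ xy ->]]].
  by rewrite cards2 (e_neq e_irr xy).
by move=> A /edgesP[x [y [xS yS _ ->]]]; rewrite subUset !sub1set xS.
Qed.

Lemma triangles_le_tri (S : {set T}) : 6 * #|triangles S| <= \sum_(v in S) tri_at e S v.
Proof.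
have -> : 6 * #|triangles S| = 2 * \sum_(V in triangles S) #|V|.
  rewrite (eq_bigr (fun _ => 3)) ?sum_nat_const; first by lia.
  by move=> V; rewrite inE => /and3P[_ /eqP].
rewrite -(sum_card_mem (S := S)); last by move=> V; rewrite inE => /andP[].
rewrite big_distrr; apply: leq_sum => v vS /=.
(* each triangle at v is seen from both of its other vertices *)
have -> : 2 * #|[set A in triangles S | v \in A]| =
    \sum_(A in [set A in triangles S | v \in A]) #|A :\ v|.
  rewrite mulnC -sum_nat_const; apply: eq_bigr => A; rewrite !inE.
  by move=> /andP[/and3P[_ /eqP A3 _] vA]; have := cardsD1 v A; rewrite A3 vA add1n
    => -[].
under eq_bigr do rewrite -sum1_card.
rewrite (exchange_big_dep (mem (neighbours e S v))) /=; last first.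
  move=> A y; rewrite !inE => /andP[/and3P[/subsetP AS _ /forall_inP adj] vA].
  move=> /andP[yv yA]; rewrite AS //=.
  by have /forall_inP/(_ y yA)/implyP := adj v vA; rewrite eq_sym; apply.
apply: leq_sum => y; rewrite in_nbr => /andP[yS vy].
rewrite sum1dep_card.
(* A triangle through [v] and [y] is determined by its third vertex. *)
apply: leq_trans (leq_imset_card (fun z => [set v; y; z]) _).
apply: subset_leq_card; apply/subsetP => A; rewrite !inE -!andbA.
move=> /and5P[/subsetP AS /eqP A3 /forall_inP adj vA /andP[yv yA]].
have : #|A :\ v :\ y| == 1.
  have := cardsD1 y (A :\ v); have := cardsD1 v A.
  by rewrite A3 vA !add1n => -[<-]; rewrite !inE yv yA add1n => -[<-].
case/cards1P => z Az; apply/imsetP; exists z.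
  have : z \in A :\ v :\ y by rewrite Az set11.
  rewrite !inE => /and3P[zy zv zA]; rewrite AS //=.
  have /forall_inP/(_ z zA)/implyP := adj v vA; rewrite eq_sym => -> //.
  by have /forall_inP/(_ z zA)/implyP := adj y yA; rewrite eq_sym => ->.
have <- : v |: (y |: (A :\ v :\ y)) = A by rewrite !setD1K // !inE yv yA.
by rewrite Az setUA.
Qed.
End Even.

Import Order.TTheory GRing.Theory Num.Theory.
Local Open Scope ring_scope.

(** * Walks in the square grid *)

Notation node := (int * int)%type.
Definition grid_nbrs (n : node) : seq node :=
  [:: (n.1 + 1, n.2); (n.1 - 1, n.2); (n.1, n.2 + 1); (n.1, n.2 - 1)].
Definition grid_adj (n m : node) := m \in grid_nbrs n.

(* A pair (i, j) also names the unit square with lower left corner (i, j); side1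
   and side2 are the two squares on either side of the grid edge hk. *)
Definition side1 (h k : node) : node := (Num.min h.1 k.1, Num.min h.2 k.2).
Definition side2 (h k : node) : node :=
  (Num.min h.1 k.1 - (h.1 == k.1)%:R, Num.min h.2 k.2 - (h.2 == k.2)%:R).
(* The step nm crosses the horizontal ray from the centre of the square s towards
   larger abscissas. *)
Definition crosses (s n m : node) :=
  [&& n.1 == m.1, s.1 < n.1 & Num.min n.2 m.2 == s.2].
Definition same_edge (h k n m : node) :=
  (n == h) && (m == k) || (n == k) && (m == h).
(** For a horizontal edge [hk] these nodes lie between the rays of its two squares. The steps
    leaving this set are [hk] itself and the vertical steps that cross exactly one of the two
    rays. *)
Definition beyond (h k p : node) :=
  [&& h.2 == k.2, p.2 == h.2 & Num.min h.1 k.1 < p.1].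

Lemma grid_adjP n m : grid_adj n m ->
  (n.1 = m.1 /\ (m.2 = n.2 + 1 \/ n.2 = m.2 + 1)) \/
  (n.2 = m.2 /\ (m.1 = n.1 + 1 \/ n.1 = m.1 + 1)).
Proof. by rewrite /grid_adj !inE => /or4P[]/eqP-> /=; lia. Qed.

Lemma grid_adj_sym : symmetric grid_adj.
Proof.
by move=> [a b] [c d]; rewrite /grid_adj !inE !xpair_eqE /=; lia.
Qed.

(* The terms beyond account for the open ends of the step: they cancel along a
   closed walk. *)
Lemma crosses_sides h k n m : grid_adj h k -> grid_adj n m ->
  crosses (side1 h k) n m (+) crosses (side2 h k) n m =
  same_edge h k n m (+) (beyond h k n (+) beyond h k m).
Proof.
have m1 (x : int) : Num.min x (x + 1) = x by lia.
have m2 (x : int) : Num.min (x + 1) x = x by lia.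
have e1 (x : int) : (x == x + 1) = false by lia.
have e2 (x : int) : (x + 1 == x) = false by lia.
move: h k n m => [a b] [c d] [x y] [z w] /grid_adjP/= H1 /grid_adjP/= H2.
rewrite /crosses /same_edge /beyond /side1 /side2 /= !xpair_eqE.
move: H1 H2 => [] [-> []->] [] [-> []->];
  rewrite ?eqxx ?m1 ?m2 ?e1 ?e2 ?minxx /=; clear; lia.
Qed.

Lemma F2_addb (b c : bool) : (b (+) c)%:R = b%:R + c%:R :> 'F_2.
Proof. by case: b; case: c => //=; apply/val_inj. Qed.

Lemma F2_addxx (x : 'F_2) : x + x = 0.
Proof. by rewrite -mulr2n -mulr_natl pchar_Fp_0 // mul0r. Qed.

Definition steps (n : node) (p : seq node) := zip (n :: p) p.
Definition crossing_parity (s n : node) (p : seq node) : 'F_2 :=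
  \sum_(w <- steps n p) (crosses s w.1 w.2)%:R.
Definition usage_parity (h k n : node) (p : seq node) : 'F_2 :=
  \sum_(w <- steps n p) (same_edge h k w.1 w.2)%:R.

(** Summing [crosses_sides] along the walk telescopes the terms [beyond], and only the two ends
    survive. *)
Lemma crossing_parity_sides h k n p : grid_adj h k -> path grid_adj n p ->
  crossing_parity (side1 h k) n p + crossing_parity (side2 h k) n p =
  usage_parity h k n p + ((beyond h k n)%:R + (beyond h k (last n p))%:R).
Proof.
move=> hk; rewrite /crossing_parity /usage_parity.
elim: p n => [|m p IH] n /=; first by rewrite !big_nil !add0r F2_addxx.
case/andP => nm /IH{}IH; rewrite !big_cons /= addrACA IH -[X in X + _ = _]F2_addb.
rewrite crosses_sides // !F2_addb.
set a := (same_edge _ _ _ _)%:R; set b := (beyond h k m)%:R.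
set c := (beyond h k n)%:R; set d := (beyond _ _ _)%:R; set u := \sum_(_ <- _) _.
transitivity (a + u + (c + d) + (b + b)); first by ring.
by rewrite F2_addxx addr0.
Qed.

Section Cut.
Variable A : node -> 'F_2.
(** With [A] a labelling of the unit squares, this detects the grid edges across which the label
    changes. *)
Definition cobound h k := A (side1 h k) + A (side2 h k).

Lemma cobound_sym h k : cobound h k = cobound k h.
Proof.
by rewrite /cobound /side1 /side2 ![Num.min k.1 _]minC ![Num.min k.2 _]minC
  ![k.1 == _]eq_sym ![k.2 == _]eq_sym.
Qed.

(** Each of the four squares around [n] borders exactly two of the four edges at [n]. *)
Lemma cobound_star n : \sum_(m <- grid_nbrs n) cobound n m = 0.
Proof.
case: n => x y; rewrite !big_cons big_nil /cobound /side1 /side2 /=.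
have m1 (z : int) : Num.min z (z + 1) = z by lia.
have m2 (z : int) : Num.min z (z - 1) = z - 1 by lia.
have e1 (z : int) : (z == z + 1) = false by lia.
have e2 (z : int) : (z == z - 1) = false by lia.
rewrite !minxx !m1 !m2 !e1 !e2 !eqxx !subr0 /= addr0.
set a := A (x, y); set b := A (x, y - 1); set c := A (x - 1, y).
set d := A (x - 1, y - 1).
have -> : a + b + (c + d + (a + c + (b + d))) =
   (a + a) + (b + b) + (c + c) + (d + d) by ring.
by rewrite !F2_addxx ?addr0.
Qed.

Lemma grid_nbrs_uniq n : uniq (grid_nbrs n).
Proof.
by case: n => x y; rewrite /grid_nbrs /= !inE !xpair_eqE; lia.
Qed.

(* Summing the stars at the nodes of C counts every edge inside C twice. *)
Lemma cut_parity (C : seq node) : uniq C ->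
  \sum_(n <- C) \sum_(m <- grid_nbrs n | m \notin C) cobound n m = 0.
Proof.
move=> uC; have inner n : \sum_(m <- grid_nbrs n | m \in C) cobound n m =
    \sum_(m <- C) (if grid_adj n m then cobound n m else 0).
  rewrite -!big_mkcond /= -[LHS]big_filter -[RHS]big_filter.
  apply: perm_big; apply: uniq_perm; rewrite ?filter_uniq ?grid_nbrs_uniq //.
  by move=> m; rewrite !mem_filter andbC.
have : \sum_(n <- C) \sum_(m <- grid_nbrs n) cobound n m = 0.
  by apply: big1 => n _; apply: cobound_star.
under eq_bigr do rewrite (bigID (mem C)) /= inner.
rewrite big_split /= => H; rewrite -[RHS]H -[LHS]add0r; congr (_ + _).
move: {H uC inner} C; elim=> [|n C IH]; first by rewrite big_nil.
rewrite big_cons big_cons.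
have -> : grid_adj n n = false by case: n => x y; rewrite /grid_adj !inE !xpair_eqE /=; lia.
under [X in _ + X]eq_bigr do rewrite big_cons.
rewrite big_split /= -IH addr0 add0r.
rewrite [X in _ = _ + X](eq_bigr (fun m => if grid_adj n m then cobound n m else 0)) ?F2_addxx //.
by move=> m _; rewrite grid_adj_sym cobound_sym.
Qed.
End Cut.

(** * Minors of the grid *)

Definition grid_minor (T : finType) (e : rel T) : Prop :=
  exists C : T -> seq node,
  [/\ forall x y n, n \in C x -> n \in C y -> x = y,
      forall x, C x != [::],
      forall x n m, n \in C x -> m \in C x ->
        exists p, [/\ path grid_adj n p, last n p = m & {subset p <= C x}]
    & forall x y, e x y -> exists n m, [/\ n \in C x, m \in C y & grid_adj n m]].

(** * Edge count for minors of the grid *)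

Section Minor.
Variables (T : finType) (e : rel T).
Hypotheses (e_sym : symmetric e) (e_irr : irreflexive e).
Hypotheses (noC4 : C4_free e) (noC5 : C5_free e).
Variable S : {set T}.
Hypothesis S0 : S != set0.
Variable C : T -> seq node.
Hypothesis C_disj : forall x y n, n \in C x -> n \in C y -> x = y.
Variable r : T -> node.
Hypothesis rC : forall x, r x \in C x.
Hypothesis C_conn : forall x n m, n \in C x -> m \in C x ->
  exists p, [/\ path grid_adj n p, last n p = m & {subset p <= C x}].
Hypothesis C_adj : forall x y, e x y ->
  exists n m, [/\ n \in C x, m \in C y & grid_adj n m].

Let m := #|edges e S|.
Let E (i : 'I_m) : {set T} := enum_val i.

(** Realises the edge [ab] as a grid walk from [r a] to [r b]: it stays in the branch set of [a],
    crosses once along [hk], then stays in the branch set of [b]. *)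
Definition connector (i : 'I_m) (c : (T * T) * (node * node) * (seq node * seq node)) :=
  let: ((a, b), (h, k), (p, q)) := c in
  [/\ [/\ a \in S, b \in S, e a b & E i = [set a; b]],
      [/\ h \in C a, k \in C b & grid_adj h k],
      [/\ path grid_adj (r a) p, last (r a) p = h & {subset p <= C a}]
    & [/\ path grid_adj k q, last k q = r b & {subset q <= C b}]].

Lemma connector_ex i : exists c, connector i c.
Proof.
have /edgesP[a [b [aS bS ab Ei]]] := enum_valP i.
have [h [k [ha kb hk]]] := C_adj ab.
have [p Hp] := C_conn (rC a) ha; have [q Hq] := C_conn kb (rC b).
by exists ((a, b), (h, k), (p, q)).
Qed.

Section Family.
Variable c : 'I_m -> (T * T) * (node * node) * (seq node * seq node).
Hypothesis cP : forall i, connector i (c i).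

Let a i := (c i).1.1.1.
Let b i := (c i).1.1.2.
Let h i := (c i).1.2.1.
Let k i := (c i).1.2.2.
Let walk i := (c i).2.1 ++ k i :: (c i).2.2.

Lemma ends i : [/\ a i \in S, b i \in S, e (a i) (b i) & E i = [set a i; b i]].
Proof. by rewrite /a /b; have := cP i; case: (c i) => [[[? ?] [? ?]] [? ?]] []. Qed.

Lemma link i : [/\ h i \in C (a i), k i \in C (b i) & grid_adj (h i) (k i)].
Proof.
by rewrite /a /b /h /k; have := cP i; case: (c i) => [[[? ?] [? ?]] [? ?]] [].
Qed.

Lemma walk_path i : path grid_adj (r (a i)) (walk i) /\
  last (r (a i)) (walk i) = r (b i).
Proof.
rewrite /walk /a /b /k; have := cP i.
case: (c i) => [[[a' b'] [h' k']] [p q]] /= [_ [_ _ hk] [p1 p2 _] [q1 q2 _]].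
by rewrite cat_path last_cat /= p1 p2 hk q1.
Qed.

Lemma ab_neq i : a i != b i.
Proof. by have [_ _ ab _] := ends i; apply: e_neq ab. Qed.

Definition together (n n' : node) := exists x, n \in C x /\ n' \in C x.

Lemma usage_same x n (p : seq node) n1 n2 : n \in C x -> {subset p <= C x} ->
  ~ together n1 n2 -> usage_parity n1 n2 n p = 0.
Proof.
move=> + + nt; rewrite /usage_parity; elim: p n => [|n' p IH] n nx px.
  by rewrite big_nil.
have n'x : n' \in C x by apply: px; rewrite inE eqxx.
rewrite big_cons /= [X in _ + X]IH // ?addr0; last first.
  by move=> z zp; apply: px; rewrite inE zp orbT.
rewrite /same_edge; case: andP => /= [[/eqP E1 /eqP E2]|_].
  by case: nt; exists x; rewrite -E1 -E2.
by case: andP => // -[/eqP E1 /eqP E2]; case: nt; exists x; rewrite -E1 -E2.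
Qed.

Lemma usage_cat n1 n2 n p q : usage_parity n1 n2 n (p ++ q) =
  usage_parity n1 n2 n p + usage_parity n1 n2 (last n p) q.
Proof.
rewrite /usage_parity; elim: p n => [|n' p IH] n /=; first by rewrite big_nil add0r.
by rewrite !big_cons IH addrA.
Qed.

(** Both ends of the walk stay inside a branch set, so [hk] is its only step between different
    branch sets. *)
Lemma usage_link i n1 n2 : ~ together n1 n2 ->
  usage_parity n1 n2 (r (a i)) (walk i) = (same_edge n1 n2 (h i) (k i))%:R.
Proof.
move=> nt; have := rC (a i); rewrite /walk /a /b /k /h; have := cP i.
case: (c i) => [[[a' b'] [h' k']] [p q]] /= [_ [_ kb _] [p1 p2 p3] [q1 q2 q3]] ra.
rewrite usage_cat (usage_same ra p3 nt) add0r p2.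
have <- : (same_edge n1 n2 h' k')%:R + usage_parity n1 n2 k' q =
    usage_parity n1 n2 h' (k' :: q) by rewrite [RHS]/usage_parity big_cons.
by rewrite (usage_same kb q3 nt) addr0.
Qed.

Lemma link_apart i : ~ together (h i) (k i).
Proof.
have [ha kb _] := link i; move=> [x [hx kx]].
by have := ab_neq i; rewrite (C_disj ha hx) (C_disj kb kx) eqxx.
Qed.

Lemma same_link i j : same_edge (h i) (k i) (h j) (k j) -> i = j.
Proof.
have [hai kbi _] := link i; have [haj kbj _] := link j.
have [_ _ _ Ei] := ends i; have [_ _ _ Ej] := ends j.
case/orP => /andP[/eqP E1 /eqP E2]; apply: enum_val_inj.
  rewrite -![enum_val _]/(E _) Ei Ej; rewrite E1 in haj; rewrite E2 in kbj.
  by rewrite (C_disj hai haj) (C_disj kbi kbj).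
rewrite -![enum_val _]/(E _) Ei Ej; rewrite E1 in haj; rewrite E2 in kbj.
by rewrite (C_disj hai kbj) (C_disj kbi haj) setUC.
Qed.

Definition incidence : 'M['F_2]_(m, #|S|) := \matrix_(i, j) (enum_val j \in E i)%:R.
Definition crossings (s : node) : 'cV['F_2]_m :=
  \col_i crossing_parity s (r (a i)) (walk i).
Let Z := kermx incidence.
(* The winding parities around the square s of the cycles spanning the cycle
   space. *)
Let phi s := Z *m crossings s.

Lemma cycles_incidence : Z *m incidence = 0.
Proof. exact: mulmx_ker. Qed.

Lemma incidence_mul i (f : T -> 'F_2) :
  (incidence *m \col_j f (enum_val j)) i ord0 = f (a i) + f (b i).
Proof.
have [aS bS _ Ei] := ends i.
rewrite mxE (eq_bigr (fun j => (enum_val j \in E i)%:R * f (enum_val j))); last first.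
  by move=> j _; rewrite !mxE.
rewrite -(big_enum_val (fun v => (v \in E i)%:R * f v)) /=.
rewrite (bigD1 (a i)) //= (bigD1 (b i)) /=; last by rewrite bS eq_sym ab_neq.
rewrite Ei !inE !eqxx orbT !mul1r big1 ?addr0 // => v /andP[/andP[_ va] vb].
by rewrite !inE (negbTE va) (negbTE vb) mul0r.
Qed.

(** The terms [beyond] at the two ends of the walks form the coboundary of a function on vertices,
    which the cycle space [Z] annihilates. *)
Lemma phi_sides n1 n2 : grid_adj n1 n2 ->
  phi (side1 n1 n2) + phi (side2 n1 n2) =
  Z *m \col_i usage_parity n1 n2 (r (a i)) (walk i).
Proof.
move=> adj; rewrite /phi -mulmxDr.
pose f v : 'F_2 := (beyond n1 n2 (r v))%:R.
have -> : crossings (side1 n1 n2) + crossings (side2 n1 n2) =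
    \col_i usage_parity n1 n2 (r (a i)) (walk i)
    + incidence *m \col_j f (enum_val j).
  apply/matrixP => i j; rewrite !ord1 [RHS]mxE incidence_mul !mxE.
  have [wp wl] := walk_path i.
  by rewrite crossing_parity_sides // wl.
by rewrite mulmxDr [X in _ + X]mulmxA cycles_incidence mul0mx addr0.
Qed.

(** A grid edge between branch sets, or to a node outside them, that realises no edge of the graph
    does not separate two faces. *)
Lemma phi_unused n1 n2 : grid_adj n1 n2 -> ~ together n1 n2 ->
  (forall i, ~~ same_edge n1 n2 (h i) (k i)) ->
  phi (side1 n1 n2) = phi (side2 n1 n2).
Proof.
move=> adj nt un; have := phi_sides adj.
rewrite (_ : \col_i _ = 0) ?mulmx0; last first.
  by apply/matrixP => i j; rewrite !mxE usage_link // (negbTE (un i)).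
move=> /eqP; rewrite addr_eq0 => /eqP ->; apply/matrixP => i j; rewrite !mxE.
by apply/eqP; rewrite eq_sym -addr_eq0 F2_addxx.
Qed.

Lemma phi_link i : phi (side1 (h i) (k i)) + phi (side2 (h i) (k i)) = col i Z.
Proof.
have [_ _ hk] := link i; rewrite phi_sides //; apply/matrixP => j l; rewrite !mxE.
rewrite (bigD1 i) //= big1 ?addr0 => [|j' j'i]; rewrite !mxE (usage_link _ (@link_apart i)).
  by rewrite /same_edge !eqxx mulr1.
case: (boolP (same_edge _ _ _ _)) => [/same_link E'|_]; last by rewrite mulr0.
by rewrite E' eqxx in j'i.
Qed.

Let N := #|{: 'cV['F_2]_m}|.
(* Squares with the same winding parities belong to the same face. *)
Definition face_indicator (psi : 'cV['F_2]_m) (s : node) : 'F_2 := (phi s == psi)%:R.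
(** Row [l] is the boundary of the face with parity vector [enum_val l]. All vectors are listed;
    those attained by no square give zero rows. *)
Definition faces : 'M['F_2]_(N, m) :=
  \matrix_(l, i) cobound (face_indicator (enum_val l)) (h i) (k i).

(** Row [i] of [Z] is the sum of the boundaries of those faces whose parity vector has a 1 in
    position [i], because crossing the link of edge [j] changes [phi] by column [j] of [Z]. *)
Lemma faces_span : (Z <= faces)%MS.
Proof.
apply/submxP; exists (\matrix_(i, l) (enum_val l : 'cV['F_2]_m) i ord0).
apply/matrixP => i j; rewrite [RHS]mxE.
have -> : Z i j = (phi (side1 (h j) (k j)) + phi (side2 (h j) (k j))) i ord0.
  by rewrite phi_link [RHS]mxE.
under eq_bigr do rewrite !mxE /cobound mulrDr.
have sum1 s : \sum_(l < N) (enum_val l : 'cV['F_2]_m) i ord0 *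
    face_indicator (enum_val l) s = phi s i ord0.
  rewrite -(big_enum_val (fun psi : 'cV['F_2]_m => psi i ord0 * face_indicator psi s)) /=.
  rewrite (bigD1 (phi s)) //= /face_indicator eqxx mulr1 big1 ?addr0 // => psi.
  by move=> ne; rewrite eq_sym (negbTE ne) mulr0.
by rewrite big_split !sum1 [LHS]mxE.
Qed.

(** By [cut_parity] the label changes across the grid edges leaving the branch set of [v] sum to 0.
    By [phi_unused] only the links contribute, and these are the edges at [v]. *)
Lemma faces_cycles : faces *m incidence = 0.
Proof.
apply/matrixP => l j; rewrite mxE [RHS]mxE.
set A := face_indicator (enum_val l); set v := enum_val j.
have := cut_parity A (undup_uniq (C v)).
set X := \sum_(n <- _) _; move=> X0; rewrite -[RHS]X0 {X0}/X.
under eq_bigr do rewrite !mxE -/A -/v.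
have one n n' : n \in C v -> n' \notin C v -> grid_adj n n' -> cobound A n n' =
    \sum_i (v \in E i)%:R * ((same_edge n n' (h i) (k i))%:R * cobound A n n').
  move=> nv n'v adj.
  have nt : ~ together n n' by move=> [x [nx n'x]]; rewrite (C_disj nv nx) n'x in n'v.
  case: (pickP (fun i => same_edge n n' (h i) (k i))) => [i si|un]; last first.
    rewrite big1 => [|i _]; last by rewrite un mul0r mulr0.
    rewrite /cobound /A /face_indicator phi_unused ?F2_addxx // => i.
    by rewrite un.
  have vE : v \in E i.
    have [_ _ _ ->] := ends i; have [ha kb _] := link i.
    case/orP: (si) => /andP[/eqP E1 /eqP E2].
      by rewrite E1 in ha; rewrite (C_disj nv ha) !inE eqxx.
    by rewrite E2 in kb; rewrite (C_disj nv kb) !inE eqxx orbT.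
  rewrite (bigD1 i) //= vE si !mul1r big1 ?addr0 // => i' i'i.
  case: (boolP (same_edge n n' (h i') (k i'))) => [si'|_]; last by rewrite mul0r mulr0.
  suff ii' : i = i' by rewrite ii' eqxx in i'i.
  apply: same_link; move: si si'; rewrite /same_edge.
  by case/orP => /andP[/eqP-> /eqP->]; case/orP => /andP[/eqP-> /eqP->];
    rewrite !eqxx ?orbT.
have -> : \sum_(n <- undup (C v)) \sum_(n' <- grid_nbrs n | n' \notin undup (C v))
     cobound A n n' =
  \sum_(n <- undup (C v)) \sum_(n' <- grid_nbrs n | n' \notin undup (C v))
   \sum_i (v \in E i)%:R * ((same_edge n n' (h i) (k i))%:R * cobound A n n').
  apply: eq_big_seq => n; rewrite mem_undup => nv.
  rewrite big_mkcond [RHS]big_mkcond; apply: eq_big_seq => n' nn'.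
  by case: ifP => //; rewrite mem_undup => n'v; apply: one.
under [RHS]eq_bigr do rewrite exchange_big.
rewrite exchange_big; apply: eq_bigr => i _ /=.
case: (boolP (v \in E i)) => vE; last first.
  rewrite mulr0 big1 // => n _; rewrite big1 // => n' _; by rewrite mul0r.
rewrite mulr1; have [ha kb hk] := link i.
have [_ _ _ Ei] := ends i.
have [n0 [n1 [n0v n1v adj S01]]] : exists n0 n1, [/\ n0 \in C v, n1 \notin C v,
    grid_adj n0 n1 & forall n n', n \in C v ->
      same_edge n n' (h i) (k i) = (n == n0) && (n' == n1)].
  move: vE; rewrite Ei !inE => /orP[]/eqP va.
    exists (h i), (k i); rewrite va; split=> //.
      by apply/negP => ka; case: (@link_apart i); exists (a i).
    move=> n n' na; rewrite /same_edge ![h i == _]eq_sym ![k i == _]eq_sym.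
    rewrite [X in _ || X]andbC; case: (eqVneq n (k i)) => [E1|]; last by rewrite orbF.
    by case: (@link_apart i); exists (a i); rewrite -E1.
  exists (k i), (h i); rewrite va grid_adj_sym; split=> //.
    by apply/negP => ka; case: (@link_apart i); exists (b i).
  move=> n n' na; rewrite /same_edge ![h i == _]eq_sym ![k i == _]eq_sym.
  rewrite [X in _ || X]andbC; case: (eqVneq n (h i)) => [E1|] //.
  by case: (@link_apart i); exists (b i); rewrite -E1.
have Alink : cobound A (h i) (k i) = cobound A n0 n1.
  have : same_edge n0 n1 (h i) (k i) by rewrite (S01 _ _ n0v) !eqxx.
  by move=> /orP[]/andP[/eqP-> /eqP->]; [reflexivity | exact: cobound_sym].
rewrite Alink; have z0 n n' : n \in C v -> (n == n0) && (n' == n1) = false ->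
    1 * ((same_edge n n' (h i) (k i))%:R * cobound A n n') = 0.
  by move=> nv ne; rewrite (S01 _ _ nv) ne mul0r mulr0.
rewrite (bigD1_seq n0) /=; [|by rewrite mem_undup|exact: undup_uniq].
rewrite [X in _ = _ + X]big1_seq; last first.
  move=> n /andP[/negbTE nn0]; rewrite mem_undup => nv.
  by apply: big1 => n' _; apply: (z0 _ _ nv); rewrite nn0.
rewrite addr0 -big_filter (bigD1_seq n1);
  [|by rewrite mem_filter mem_undup n1v|by apply: filter_uniq; exact: grid_nbrs_uniq].
rewrite big1; last by move=> n' /negbTE n'1; apply: (z0 _ _ n0v); rewrite n'1 andbF.
by rewrite /= addr0 (S01 _ _ n0v) !eqxx !mul1r.
Qed.

(** Only the faces of the two squares beside the link of an edge can have it in their boundary. *)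
Lemma faces_col i : (#|[set l | faces l i != 0%R]| <= 2)%N.
Proof.
rewrite -(card_imset _ (@enum_val_inj _ {: 'cV['F_2]_m})).
apply: leq_trans (_ : #|[set phi (side1 (h i) (k i)); phi (side2 (h i) (k i))]| <= 2)%N;
  last by rewrite cards2; case: eqP.
apply: subset_leq_card; apply/subsetP => psi /imsetP[l].
rewrite !inE mxE /cobound /face_indicator => + ->; apply: contraR.
rewrite negb_or ![enum_val l == _]eq_sym => /andP[/negbTE-> /negbTE->].
by rewrite addr0.
Qed.

(** Every edge has two ends, so the all-ones vector is in the kernel; it is nonzero because [S] is
    nonempty. *)
Lemma incidence_rank : (\rank incidence < #|S|)%N.
Proof.
have : incidence *m \col_j (fun _ => 1) (enum_val j) = 0.
  by apply/matrixP => i j; rewrite ord1 (incidence_mul i (fun _ => 1)) mxE F2_addxx.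
move=> /mulmx0_rank_max; apply: leq_trans.
rewrite -addn1 leq_add2l lt0n mxrank_eq0; have [v vS] := set0Pn _ S0.
apply/eqP => /matrixP/(_ (enum_rank_in vS v) ord0) /eqP.
by rewrite !mxE oner_eq0.
Qed.

Let M := rowsub (maxrankfun faces) faces.

Lemma M_rows_inj : injective (fun l => row l M).
Proof.
have free : row_free M by apply: maxrowsub_free.
move=> l l'; rewrite !rowE => /(row_free_inj free)/matrixP/(_ ord0 l).
by rewrite !mxE !eqxx /=; case: eqVneq => //= _ /eqP; rewrite oner_eq0.
Qed.

Let supp l : {set {set T}} := [set E i | i in [pred i | M l i != 0]].

Lemma mem_supp l i : (E i \in supp l) = (M l i != 0).
Proof.
apply/imsetP/idP => [[j Mj /enum_val_inj->]|Mi]; first exact: Mj.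
by exists i.
Qed.

Lemma supp_edges l : supp l \subset edges e S.
Proof. by apply/subsetP => A /imsetP[i _ ->]; apply: enum_valP. Qed.

Lemma F2_neq0 (x : 'F_2) : x = (x != 0)%:R.
Proof. by case: x => -[|[|//]] lt; apply/val_inj. Qed.

Lemma supp_inj : injective supp.
Proof.
move=> l l' ss; apply: M_rows_inj; apply/rowP => i; rewrite !mxE.
have := mem_supp l i; rewrite ss mem_supp => H.
by have := F2_neq0 (M l i); have := F2_neq0 (M l' i); rewrite !mxE in H *;
  rewrite H => <- <-.
Qed.

Lemma supp_neq0 l : supp l != set0.
Proof.
have free : row_free M by apply: maxrowsub_free.
apply/eqP => s0; have rl : row l M = 0.
  apply/rowP => i; rewrite [LHS]mxE [RHS]mxE; apply/eqP.
  by rewrite -[_ == 0]negbK -mem_supp s0 inE.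
move: rl; rewrite rowE -[RHS](mul0mx _ M) => /(row_free_inj free).
by move=> /matrixP/(_ ord0 l)/eqP; rewrite !mxE !eqxx oner_eq0.
Qed.

Lemma supp_even l : even_set (supp l).
Proof.
move=> v; case: (boolP (v \in S)) => vS; last first.
  rewrite (_ : [set A in supp l | v \in A] = set0) ?cards0 //.
  apply/setP => A; rewrite !inE; apply/negP => /andP[/(subsetP (supp_edges l))].
  by move=> /edgesP[x [y [xS yS _ ->]]]; rewrite !inE => /orP[]/eqP E';
    rewrite E' ?xS ?yS in vS.
have : M *m incidence = 0.
  by rewrite /M mul_rowsub_mx faces_cycles; apply/matrixP => i j; rewrite !mxE.
move=> /matrixP/(_ l (enum_rank_in vS v)); rewrite mxE [RHS]mxE.
have -> : \sum_j M l j * incidence j (enum_rank_in vS v) =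
    #|[set A in supp l | v \in A]|%:R.
  rewrite -[X in _ = X%:R]sum1_card natr_sum [RHS](eq_bigl (fun A => (A \in edges e S) &&
    ((A \in supp l) && (v \in A)))); last first.
    move=> A; rewrite in_set; case: (boolP (A \in supp l)) => [AX|_]; last by rewrite andbF.
    by rewrite (subsetP (supp_edges l) A AX).
  rewrite [RHS]big_enum_val_cond /= [RHS]big_mkcond; apply: eq_bigr => j _.
  rewrite mem_supp [incidence _ _]mxE enum_rankK_in // [LHS]mulrC.
  rewrite {1}(F2_neq0 (M l j)) -/(E j).
  by case: (v \in E j); case: (M l j != 0); rewrite ?mul0r ?mul1r.
by move/eqP; rewrite -(dvdn_pcharf (pchar_Fp (erefl : prime 2))) dvdn2.
Qed.

Lemma supp_card_sum : (\sum_l #|supp l| <= 2 * m)%N.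
Proof.
have -> : (\sum_l #|supp l| = \sum_l \sum_(i < m) (M l i != 0%R))%N.
  apply: eq_bigr => l _; rewrite card_imset; last exact: enum_val_inj.
  by rewrite -sum1_card big_mkcond.
rewrite exchange_big /= mulnC -[m in (m * 2)%N]card_ord -sum_nat_const.
apply: leq_sum => i _; apply: leq_trans (faces_col i).
have -> : (\sum_l (M l i != 0%R) = #|[set l | M l i != 0%R]|)%N.
  by rewrite -sum1_card [RHS]big_mkcond; apply: eq_bigr => l _; rewrite inE; case: eqP.
rewrite -(card_imset _ (@maxrankfun_inj _ _ _ faces)).
apply: subset_leq_card; apply/subsetP => l' /imsetP[l].
by rewrite !inE [M l i]mxE => Ml ->.
Qed.

Lemma edge_bound : (4 * m + 6 <= 6 * #|S| + 3 * #|triangles e S|)%N.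
Proof.
(* The faces span the cycle space, whose dimension is at least m - |S| + 1. *)
have rk : (m < \rank faces + #|S|)%N.
  have := mxrankS faces_span; rewrite mxrank_ker; have := incidence_rank.
  have := rank_leq_row incidence.
  by move: (\rank incidence); move: (\rank faces); move: #|S| (m); clear; lia.
have large l : (6 <= #|supp l| + 3 * (#|supp l| == 3))%N.
  have := even_set_card e_sym e_irr noC4 noC5 (supp_edges l) (@supp_even l) (supp_neq0 l).
  case=> [[V VS ->]|ge6]; last by apply: leq_trans ge6 _; apply: leq_addr.
  by rewrite (card_pairs VS).
(* Distinct basis members have distinct supports, hence the three-edge ones come from distinct
   triangles. *)
have small : (\sum_l (#|supp l| == 3) <= #|triangles e S|)%N.
  have -> : (\sum_l (#|supp l| == 3) = #|[set l | #|supp l| == 3%N]|)%N.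
    by rewrite -sum1_card [RHS]big_mkcond; apply: eq_bigr => l _; rewrite inE; case: eqP.
  rewrite -(card_imset _ supp_inj).
  apply: leq_trans (leq_imset_card (@pairs T) _); apply: subset_leq_card.
  apply/subsetP => X /imsetP[l]; rewrite inE => /eqP l3 ->.
  have := even_set_card e_sym e_irr noC4 noC5 (supp_edges l) (@supp_even l) (supp_neq0 l).
  by case=> [[V VS ->]|]; [apply: imset_f | rewrite l3].
have := supp_card_sum.
have : (\sum_(l < \rank faces) 6 <= \sum_l (#|supp l| + 3 * (#|supp l| == 3)))%N.
  by apply: leq_sum => l _; apply: large.
rewrite sum_nat_const card_ord big_split -big_distrr /=.
move: small rk; move: (\sum_l _)%N => x; move: (\sum_l #|supp l|)%N => y.
move: (\rank faces); move: #|S| #|triangles e S| (m) x y; clear; lia.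
Qed.

End Family.
End Minor.

Lemma grid_minor_sparse (T : finType) (e : rel T) (S : {set T}) :
  symmetric e -> irreflexive e -> C4_free e -> C5_free e -> grid_minor e ->
  S != set0 ->
  (\sum_(v in S) 4 * degree e S v < 12 * #|S| + \sum_(v in S) tri_at e S v)%N.
Proof.
move=> e_sym e_irr noC4 noC5 [C [C_disj C0 C_conn C_adj]] S0.
have rex x : exists n, n \in C x.
  by move: (C0 x); case: (C x) => // n s _; exists n; rewrite inE eqxx.
have [r rC] := choice rex.
have [c cP] := choice (connector_ex (S := S) rC C_conn C_adj).
have := edge_bound e_sym e_irr noC4 noC5 S0 C_disj rC cP.
have := handshake e_sym e_irr S; have := triangles_le_tri e S.
rewrite -big_distrr /=.
move: (\sum_(v in S) degree e S v)%N (\sum_(v in S) tri_at e S v)%N #|S| #|edges e S|.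
move: #|triangles e S|; clear; lia.
Qed.

(** * Connected sets of grid nodes *)

Definition reach (P : node -> Prop) (n m : node) := exists p,
  [/\ path grid_adj n p, last n p = m & forall z, z \in n :: p -> P z].

Lemma reach_refl (P : node -> Prop) n : P n -> reach P n n.
Proof. by exists [::]; split=> // z; rewrite inE => /eqP->. Qed.

Lemma reach_trans (P : node -> Prop) n m k : reach P n m -> reach P m k -> reach P n k.
Proof.
move=> [p [p1 p2 pP]] [q [q1 q2 qP]]; exists (p ++ q); split.
- by rewrite cat_path p1 p2.
- by rewrite last_cat p2.
- move=> z; rewrite -cat_cons mem_cat => /orP[/pP//|zq].
  by apply: qP; rewrite inE zq orbT.
Qed.

Lemma reach1 (P : node -> Prop) n m : P n -> P m -> grid_adj n m -> reach P n m.
Proof.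
move=> Pn Pm nm; exists [:: m]; split=> //=; first by rewrite nm.
by move=> z; rewrite !inE => /orP[]/eqP->.
Qed.

Lemma reach_sym (P : node -> Prop) n m : reach P n m -> reach P m n.
Proof.
move=> [p [+ <-]]; elim: p n => [|k p IH] n /= => [_|/andP[nk kp]] H.
  by apply/reach_refl/H; rewrite inE.
have Hk z : z \in k :: p -> P z by move=> zp; apply: H; rewrite inE zp orbT.
apply: reach_trans (IH k kp Hk) _; apply: reach1.
- by apply: Hk; rewrite inE eqxx.
- by apply: H; rewrite inE eqxx.
- by rewrite grid_adj_sym.
Qed.

Lemma reach_sub (P Q : node -> Prop) n m : (forall z, P z -> Q z) ->
  reach P n m -> reach Q n m.
Proof. by move=> PQ [p [? ? H]]; exists p; split=> // z /H/PQ. Qed.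

Lemma path_reach n p z : path grid_adj n p -> z \in n :: p ->
  reach (fun w => w \in n :: p) n z.
Proof.
elim: p n => [|k p IH] n /=; first by rewrite inE => _ /eqP->; apply: reach_refl; rewrite inE.
case/andP => nk kp; rewrite inE => /orP[/eqP->|zp].
  by apply: reach_refl; rewrite inE eqxx.
apply: (@reach_trans _ _ k).
  by apply: reach1; rewrite // !inE eqxx ?orbT.
by apply: reach_sub (IH k kp zp) => w wp; rewrite inE wp orbT.
Qed.

Lemma reach_first_hit (P : node -> Prop) (U : pred node) n m :
  reach P n m -> ~~ U n -> U m ->
  exists p z, [/\ path grid_adj n p, forall w, w \in n :: p -> P w /\ ~~ U w,
    grid_adj (last n p) z & U z].
Proof.
move=> [p [+ <-]]; elim: p n => [|k p IH] n /= => [_ _ /negbTE-> //|].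
move=> /andP[nk kp] H nU mU.
have Pn : P n by apply: H; rewrite inE eqxx.
case: (boolP (U k)) => kU.
  by exists [::], k; split=> // w; rewrite inE => /eqP->.
have [|//|//|q [z [q1 q2 q3 q4]]] := IH k kp.
  by move=> w wp; apply: H; rewrite inE wp orbT.
exists (k :: q), z; split=> //=; first by rewrite nk.
by move=> w; rewrite inE => /orP[/eqP->|/q2].
Qed.

(** A diagonal move is replaced by two grid steps through the corner [(m.1, n.2)], which must
    therefore satisfy [P] as well. *)
Lemma reach_king (P : node -> Prop) n m : `|n.1 - m.1| <= 1 -> `|n.2 - m.2| <= 1 ->
  P n -> P (m.1, n.2) -> P m -> reach P n m.
Proof.
case: n m => a b [c d] /= ac bd Pn Pk Pm; apply: (@reach_trans _ _ (c, b)).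
  have [<-|ne] := eqVneq a c; first exact: reach_refl.
  by apply: reach1 => //; rewrite /grid_adj !inE !xpair_eqE /=; lia.
have [->|ne] := eqVneq b d; first exact: reach_refl.
by apply: reach1 => //; rewrite /grid_adj !inE !xpair_eqE /=; lia.
Qed.

Definition box (r : node) (M : nat) : seq node :=
  [seq (r.1 + (i%:Z - M%:Z), r.2 + (j%:Z - M%:Z)) |
    i <- iota 0 (2 * M).+1, j <- iota 0 (2 * M).+1].

Lemma mem_box r M n :
  (n \in box r M) = (`|n.1 - r.1| <= M%:Z) && (`|n.2 - r.2| <= M%:Z).
Proof.
case: n r => a b [c d]; apply/allpairsP/idP.
  by move=> [[i j] []]; rewrite !mem_iota /= => i1 j1 [-> ->]; lia.
move=> H; exists (absz (a - c + M%:Z), absz (b - d + M%:Z)).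
by rewrite !mem_iota; move: H => /= H; split; [lia|lia|congr pair; lia].
Qed.

Lemma box_reach r M n : n \in box r M -> reach (fun z => z \in box r M) n r.
Proof.
case: r => c d; have [k] := ubnP (`|n.1 - c| + `|n.2 - d|)%N.
elim: k n => // k IH n lt nb.
have step n' : grid_adj n n' -> n' \in box (c, d) M ->
    (`|n'.1 - c| + `|n'.2 - d| < `|n.1 - c| + `|n.2 - d|)%N ->
    reach (fun z => z \in box (c, d) M) n (c, d).
  move=> nn' n'b lt'; apply: (@reach_trans _ _ n'); first exact: reach1.
  by apply: IH => //; apply: leq_trans lt' _; rewrite -ltnS.
move: nb step; rewrite mem_box; case: n lt => a b /= lt nb step.
have [ac|ac|ac] := ltgtP a c.
- by apply: (step (a + 1, b)); rewrite ?mem_box /grid_adj ?inE ?xpair_eqE /=; lia.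
- by apply: (step (a - 1, b)); rewrite ?mem_box /grid_adj ?inE ?xpair_eqE /=; lia.
have [bd|bd|bd] := ltgtP b d.
- by apply: (step (a, b + 1)); rewrite ?mem_box /grid_adj ?inE ?xpair_eqE /=; lia.
- by apply: (step (a, b - 1)); rewrite ?mem_box /grid_adj ?inE ?xpair_eqE /=; lia.
by rewrite ac bd; apply: reach_refl; rewrite mem_box /= !subrr normr0.
Qed.

From mathcomp Require Import all_classical all_reals all_analysis.
Import numFieldNormedType.Exports.

(** * From plane drawings to grid minors *)

Section Compactness.
Variable R : realType.
Local Open Scope classical_set_scope.

(** Each point of [K] has a ball of some radius [d] missing [L]; radius [d / 2] then works for all
    points within [d / 2], and compactness makes the choice uniform. *)
Lemma compact_separated (V : pseudoMetricNormedZmodType R) (K L : set V) :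
  compact K -> closed L -> K `&` L = set0 ->
  \forall d \near 0^'+, forall p q, K p -> L q -> ~ ball p d q.
Proof.
move=> /compact_near_coveringP cK cL KL0.
have : \forall d \near (0:R)^'+, K `<=` (fun p => forall q, L q -> ~ ball p d q).
  apply: cK => p Kp.
  have : nbhs p (~` L).
    apply: open_nbhs_nbhs; split; first exact: closed_openC.
    by move=> Lp; have : (K `&` L) p by []; rewrite KL0.
  case/nbhs_ballP => d /= d0 dL.
  exists (ball p (d / 2), [set d' | d' < d / 2]).
    by split; [apply: near_ball; rewrite divr_gt0 | apply: nbhs_right_lt; rewrite divr_gt0].
  move=> [p' d'] /= [pp' d'd] q Lq p'q; apply: (dL q) => //.
  rewrite [d]splitr; apply: ball_triangle pp' _.
  by apply: le_ball p'q; apply: ltW.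
by apply: filterS => d H p q Kp; apply: H.
Qed.

Lemma uniform_steps (V : pseudoMetricType R) (g : R -> V) (eps : R) :
  {within `[0, 1], continuous g} -> 0 < eps ->
  exists2 N : nat, (0 < N)%N & forall i, (i < N)%N ->
    ball (g (i%:R / N%:R)) eps (g (i.+1%:R / N%:R)).
Proof.
move=> cg e0; have /compact_near_coveringP/near_covering_withinP cI := @segment_compact R 0 1.
have /cI near_unif : forall t : R, (`[0, 1] : set R) t -> \forall t' \near t & d \near (0:R)^'+,
    (`[0, 1] : set R) t' -> forall s : R, (`[0, 1] : set R) s -> `|t' - s| < d -> ball (g t') eps (g s).
  move=> t It; have /subspace_continuousP/(_ t It) := cg.
  move=> /cvg_ballP/(_ (eps / 2)) []; first by rewrite divr_gt0.
  move=> d /= d0 dH.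
  exists (ball t (d / 2), [set d' | d' < d / 2]).
    by split; [apply: nbhsx_ballx; rewrite divr_gt0 | apply: nbhs_right_lt; rewrite divr_gt0].
  move=> [t' d'] /= [tt' d'd] It' s Is t's.
  rewrite [eps]splitr; apply: (@ball_triangle _ _ (g t)).
    apply: ball_sym; apply: dH => //=.
    by apply: lt_trans tt' _; rewrite ltr_pdivrMr // ltr_pMr // ltr1n.
  apply: dH => //=; rewrite [d]splitr; apply: (ball_triangle tt').
  exact: lt_trans t's d'd.
have [N [N0 HN]] : exists N : nat, (0 < N)%N /\ forall t : R, (`[0, 1] : set R) t ->
    forall s : R, (`[0, 1] : set R) s -> `|t - s| <= N%:R^-1 -> ball (g t) eps (g s).
  have [d /= d0 dH] := near_unif.
  have d2 : 0 < d / 2 by rewrite divr_gt0.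
  (* This makes the mesh 1 / N smaller than [d / 2], an admissible radius. *)
  exists (Num.truncn (2 / d)).+1; split=> // t It s Is ts.
  apply: (dH (d / 2)) => //=.
    by rewrite sub0r normrN gtr0_norm // ltr_pdivrMr // ltr_pMr // ltr1n.
  apply: le_lt_trans ts _; rewrite -[d / 2]invrK invf_div ltf_pV2 ?posrE ?divr_gt0 //.
  by rewrite truncnS_gt.
exists N => // i iN.
have N0' : (0 : R) < N%:R by rewrite ltr0n.
apply: HN.
- by rewrite /= in_itv /= divr_ge0 //= ler_pdivrMr // mul1r ler_nat ltnW.
- by rewrite /= in_itv /= divr_ge0 //= ler_pdivrMr // mul1r ler_nat.
rewrite -mulrBl normrM [ `|N%:R^-1| ]gtr0_norm ?invr_gt0 //.
by rewrite -[i.+1%:R]natr1 opprD addNKr normrN normr1 mul1r.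
Qed.
End Compactness.

(** * Rounding the scaled plane to grid nodes *)

Section Cells.
Variables (R : realType) (s : R).
Hypothesis s0 : 0 < s.

Definition cell (q : R * R) : node := (Num.floor (s * q.1), Num.floor (s * q.2)).

Definition close_to (d : R) (n : node) (q : R * R) :=
  `|n.1%:~R - s * q.1| <= d /\ `|n.2%:~R - s * q.2| <= d.

Lemma ball_scale (p q : R * R) d : ball p d q <->
  `|s * p.1 - s * q.1| < s * d /\ `|s * p.2 - s * q.2| < s * d.
Proof.
by rewrite -!mulrBr !normrM !(gtr0_norm s0) !(ltr_pM2l s0).
Qed.

Lemma floor_close (a b : R) : `|a - b| < 1 -> `|Num.floor a - Num.floor b| <= 1.
Proof.
have half (x y : R) : x - y < 1 -> Num.floor x - Num.floor y <= 1.
  move=> xy; rewrite -ltzD1 -(ltr_int R) rmorphB rmorphD /=.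
  have /andP[x1 _] := floor_itv x; have /andP[_] := floor_itv y.
  by rewrite intrD => y2; lra.
rewrite ltr_norml => /andP[ab1 ab2]; rewrite ler_norml half // andbT.
by rewrite lerNl opprB half // -opprB ltrNl.
Qed.

Lemma floor_dist (a : R) : `|(Num.floor a)%:~R - a| <= 1.
Proof.
have /andP[a1] := floor_itv a; rewrite intrD => a2.
by rewrite ler_norml; lra.
Qed.

Lemma cell_close q : close_to 1 (cell q) q.
Proof. by split; apply: floor_dist. Qed.

(** The arc is sampled so finely that consecutive cells differ by a king's move. The corner node of
    such a move is off by at most 1 from rounding and 1 from the sampling step, whence the distance
    2. *)
Lemma arc_reach (g : R -> R * R) : {within `[0, 1], continuous g}%classic ->
  reach (fun n => exists t, t \in `[0, 1] /\ close_to 2 n (g t))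
    (cell (g 0)) (cell (g 1)).
Proof.
move=> cg; have [|N N0 HN] := uniform_steps cg (_ : 0 < s^-1); first by rewrite invr_gt0.
have N0' : (0 : R) < N%:R by rewrite ltr0n.
have tI i : (i <= N)%N -> (i%:R / N%:R : R) \in `[0, 1].
  by move=> iN; rewrite in_itv /= divr_ge0 //= ler_pdivrMr // mul1r ler_nat.
have near_cell t : t \in `[0, 1] -> exists t', t' \in `[0, 1] /\ close_to 2 (cell (g t)) (g t').
  move=> It; exists t; split=> //; have [c1 c2] := cell_close (g t).
  by split; [apply: le_trans c1 _|apply: le_trans c2 _]; rewrite ler1n.
suff H i : (i <= N)%N -> reach (fun n => exists t, t \in `[0, 1] /\ close_to 2 n (g t))
    (cell (g 0)) (cell (g (i%:R / N%:R))).
  by have := H N (leqnn N); rewrite divff ?gt_eqF.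
elim: i => [|i IH] iN.
  by rewrite mul0r; apply/reach_refl/near_cell; rewrite in_itv /= lexx ler01.
apply: reach_trans (IH (ltnW iN)) _.
have := HN i iN; rewrite ball_scale divff ?gt_eqF // => -[b1 b2].
have Ii := tI i (ltnW iN); have Ii1 := tI i.+1 iN.
set p := g (i%:R / N%:R) in b1 b2 *; set q := g (i.+1%:R / N%:R) in b1 b2 *.
apply: reach_king.
- exact: floor_close.
- exact: floor_close.
- exact: near_cell.
- exists (i%:R / N%:R); split=> //; rewrite -/p; split=> /=; last first.
    by apply: le_trans (floor_dist _) _; rewrite ler1n.
  have := floor_dist (s * q.1); move: b1; rewrite ltr_norml !ler_norml.
  by move=> /andP[? ?] /andP[? ?]; lra.
- exact: near_cell.
Qed.
End Cells.

(** * Separation constants of a plane drawing *)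

Section Drawing.
Variables (R : realType) (T : finType) (e : rel T).
Hypotheses (e_sym : symmetric e) (e_irr : irreflexive e).
Variables (pos : T -> R * R) (arc : {set T} -> set (R * R)).
Hypothesis drawing : plane_drawing e pos arc.

Lemma arc_compact x y : e x y -> compact (arc [set x; y]).
Proof.
case: drawing => _ H _ _ /H [g [cg _ _ _ ->]].
by apply: continuous_compact cg _; apply: segment_compact.
Qed.

Lemma separation_radius : exists2 rho : R, 0 < rho &
  (forall x y, x != y -> ~ ball (pos x) (4 * rho) (pos y)) /\
  (forall x y z p, e x y -> z \notin [set x; y] -> arc [set x; y] p ->
    ~ ball p (3 * rho) (pos z)).
Proof.
case: drawing => pos_inj _ arc_pos _.
have cp z : compact [set pos z]%classic by exact: compact_set1.
have clp z : closed [set pos z]%classic.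
  exact: (compact_closed (@norm_hausdorff _ _) (cp z)).
have sep1 : \forall d \near ((0 : R)^'+)%classic, forall u : T * T, u.1 != u.2 ->
    ~ ball (pos u.1) d (pos u.2).
  apply: filter_forall => -[x y] /=; case: (eqVneq x y) => [_|xy].
    by apply: filterE.
  have := @compact_separated R _ [set pos x]%classic [set pos y]%classic
    (cp x) (clp y).
  have E0 : ([set pos x] `&` [set pos y] = set0)%classic.
    by apply/seteqP; split=> // z [/= -> /pos_inj/eqP]; rewrite (negbTE xy).
  by move=> /(_ E0); apply: filterS => d H _; apply: H.
have sep2 : \forall d \near ((0 : R)^'+)%classic, forall u : T * T * T,
    e u.1.1 u.1.2 -> u.2 \notin [set u.1.1; u.1.2] ->
    forall p, arc [set u.1.1; u.1.2] p -> ~ ball p d (pos u.2).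
  apply: filter_forall => -[[x y] z] /=.
  case: (boolP (e x y)) => [exy|_]; last by apply: filterE.
  case: (boolP (z \in [set x; y])) => [_|zxy]; first by apply: filterE.
  have := @compact_separated R _ (arc [set x; y]) [set pos z]%classic
    (arc_compact exy) (clp z).
  have E0 : (arc [set x; y] `&` [set pos z] = set0)%classic.
    apply/seteqP; split=> // p [/= ap pz]; rewrite pz in ap.
    by case: (arc_pos x y z exy ap) => E; rewrite E !inE eqxx ?orbT in zxy.
  by move=> /(_ E0); apply: filterS => d H _ _ p ap; apply: H.
have [d /= d0 dH] : nbhs ((0 : R)^'+)%classic _ := filterI sep1 sep2.
(* With rho = d / 10 both 4 * rho and 3 * rho stay below [d]. *)
have d10 : 0 < d / 10 by rewrite divr_gt0.
exists (d / 10) => //.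
have inB c : 0 < c -> c < 5 -> `|0 - c * (d / 10)| < d /\ 0 < c * (d / 10).
  move=> c0 c5; rewrite mulr_gt0 // sub0r normrN gtr0_norm ?mulr_gt0 //; split=> //.
  by nra.
split.
  move=> x y xy; have [||b1 b2] := inB 4; [lra|lra|].
  by have [H _] := dH _ b1 b2; apply: (H (x, y)).
move=> x y z p exy zxy ap; have [||b1 b2] := inB 3; [lra|lra|].
by have [_ H] := dH _ b1 b2; apply: (H (x, y, z)).
Qed.

(** Distinct arcs meet only at vertices, so outside the open balls of radius [rho] around the
    vertices they are disjoint compact sets. *)
Lemma separation_arcs (rho : R) : 0 < rho ->
  exists2 d : R, 0 < d & forall x y u v p q, e x y -> e u v ->
    [set x; y] != [set u; v] -> arc [set x; y] p -> arc [set u; v] q ->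
    (forall z, ~ ball p rho (pos z)) -> (forall z, ~ ball q rho (pos z)) ->
    ~ ball p d q.
Proof.
move=> rho0; case: drawing => _ _ _ arcI.
pose F : set (R * R) := (\bigcap_(z in [set: T]) ~` ball (pos z) rho)%classic.
have cF : closed F by apply: closed_bigI => z _; apply/open_closedC/ball_open.
have sep : \forall d \near ((0 : R)^'+)%classic, forall u : (T * T) * (T * T),
    e u.1.1 u.1.2 -> e u.2.1 u.2.2 -> [set u.1.1; u.1.2] != [set u.2.1; u.2.2] ->
    forall p q, arc [set u.1.1; u.1.2] p -> F p -> arc [set u.2.1; u.2.2] q -> F q ->
    ~ ball p d q.
  apply: filter_forall => -[[x y] [u v]] /=.
  case: (boolP (e x y)) => [exy|_]; last by apply: filterE.
  case: (boolP (e u v)) => [euv|_]; last by apply: filterE.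
  case: (boolP ([set x; y] != [set u; v])) => [ne|_]; last by apply: filterE.
  have c1 := compact_closedI (arc_compact exy) cF.
  have c2 := compact_closedI (arc_compact euv) cF.
  have := compact_separated c1 (compact_closed (@norm_hausdorff _ _) c2).
  have E0 : ((arc [set x; y] `&` F) `&` (arc [set u; v] `&` F) = set0)%classic.
    apply/seteqP; split=> // p [[p1 Fp] [p2 _]].
    have [z _ zp] := arcI x y u v exy euv ne p (conj p1 p2).
    by case: (Fp z I); rewrite zp; apply: ballxx.
  by move=> /(_ E0); apply: filterS => d H _ _ _ p q ? ? ? ?; apply: H.
have [d /= d0 dH] : nbhs ((0 : R)^'+)%classic _ := sep.
exists (d / 2); first by rewrite divr_gt0.
move=> x y u v p q exy euv ne ap aq Fp Fq; apply: (dH (d / 2) _ _ ((x, y), (u, v))) => //=.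
- by rewrite sub0r normrN gtr0_norm ?divr_gt0 // ltr_pdivrMr // ltr_pMr // ltr1n.
- by rewrite divr_gt0.
- by move=> z _ /ball_sym; apply: Fp.
- by move=> z _ /ball_sym; apply: Fq.
Qed.
End Drawing.

(* The branch set of x consists of a box around x and of the lattice walks along
   the edges from x to vertices y of larger rank, up to the box around y. *)
Lemma planar_grid_minor (R : realType) (T : finType) (e : rel T) :
  symmetric e -> irreflexive e -> planar R e -> grid_minor e.
Proof.
move=> e_sym e_irr [pos [arc drawing]].
have [rho rho0 [far_pos far_arc]] := separation_radius drawing.
have [|d d0 far_arcs] := @separation_arcs _ _ _ _ _ drawing (rho / 2).
  by rewrite divr_gt0.
(* Scaling by s = M / rho turns distance rho into the box radius M. The bound M >= 4 gives M - 2 >=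
   M / 2, so an arc point close to a node outside a box is at distance at least rho / 2 from its
   vertex. The bound on [M * d] gives s * d > 5 > 2 + 2, so two points close to one node are within
   [d]. *)
have [M M4 Md] : exists2 M : nat, (4 <= M)%N & 5 * rho < M%:R * d.
  exists (maxn 4 (Num.truncn (5 * rho / d)).+1); first exact: leq_maxl.
  rewrite -ltr_pdivrMr //; apply: lt_le_trans (truncnS_gt _) _.
  by rewrite ler_nat leq_maxr.
have M4' : 4 <= M%:R :> R by rewrite ler_nat.
pose s : R := M%:R / rho.
have s0 : 0 < s by rewrite divr_gt0 // ltr0n; apply: leq_trans M4.
have srho : s * rho = M%:R by rewrite divfK ?gt_eqF.
have sd : 5 < s * d by rewrite /s mulrAC ltr_pdivlMr.
pose r v := cell s (pos v).
pose U v := box (r v) M.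
have scale p q c : ball p c q <->
    `|s * p.1 - s * q.1| < s * c /\ `|s * p.2 - s * q.2| < s * c.
  exact: ball_scale.
clearbody s.
have U_near v n : n \in U v -> close_to s (M%:R + 1) n (pos v).
  rewrite mem_box => /andP[n1 n2]; have [c1 c2] := cell_close s (pos v).
  have n1' : `|n.1%:~R - (r v).1%:~R| <= M%:R :> R.
    by rewrite -rmorphB /= -intr_norm -[M%:R]/(M%:Z%:~R) ler_int.
  have n2' : `|n.2%:~R - (r v).2%:~R| <= M%:R :> R.
    by rewrite -rmorphB /= -intr_norm -[M%:R]/(M%:Z%:~R) ler_int.
  by split; [apply: le_trans (ler_distD (r v).1%:~R _ _) _
    | apply: le_trans (ler_distD (r v).2%:~R _ _) _]; apply: lerD.
have U_far v n : n \notin U v -> M%:R <= `|n.1%:~R - s * (pos v).1| \/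
    M%:R <= `|n.2%:~R - s * (pos v).2|.
  have far1 (a : int) (b : R) : M%:Z < `|a - Num.floor b| -> M%:R <= `|a%:~R - b|.
    rewrite -lezD1 -(ler_int R) rmorphD /= intr_norm rmorphB /= => H.
    have H1 := floor_dist b; rewrite distrC in H1.
    have := le_trans H (ler_distD b a%:~R (Num.floor b)%:~R).
    by rewrite -[M%:~R]/(M%:R); lra.
  by rewrite mem_box negb_and -!ltNge => /orP[]/far1; [left | right].
have near_U v p n : close_to s 2 n p -> n \in U v -> ball p (3 * rho) (pos v).
  move=> [p1 p2] /U_near[v1 v2]; rewrite scale mulrCA srho.
  have H (a b c : R) : `|a - b| <= 2 -> `|a - c| <= M%:R + 1 -> `|b - c| < 3 * M%:R.
    rewrite distrC => ab ac; apply: le_lt_trans (ler_distD a b c) _; lra.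
  by split; [apply: H p1 v1 | apply: H p2 v2].
have near_notU v p n : close_to s 2 n p -> n \notin U v -> ~ ball p (rho / 2) (pos v).
  move=> [p1 p2] /U_far nv; rewrite scale mulrA srho.
  have H (a b c : R) : `|a - b| <= 2 -> M%:R <= `|a - c| -> `|b - c| < M%:R / 2 -> False.
    by move=> ab ac bc; have := ler_distD b a c; lra.
  by case: nv => nv [b1 b2]; [apply: H p1 nv b1 | apply: H p2 nv b2].
have near_near p q n : close_to s 2 n p -> close_to s 2 n q -> ball p d q.
  move=> [p1 p2] [q1 q2]; rewrite scale.
  have H (a b c : R) : `|a - b| <= 2 -> `|a - c| <= 2 -> `|b - c| < s * d.
    rewrite distrC => ab ac; apply: le_lt_trans (ler_distD a b c) _; lra.
  by split; [apply: H p1 q1 | apply: H p2 q2].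
have U_disj x y n : n \in U x -> n \in U y -> x = y.
  move=> /U_near[x1 x2] /U_near[y1 y2]; apply/eqP; apply: contraT => /far_pos[].
  rewrite scale mulrCA srho.
  have H (a b c : R) : `|a - b| <= M%:R + 1 -> `|a - c| <= M%:R + 1 ->
      `|b - c| < 4 * M%:R.
    rewrite distrC => ab ac; apply: le_lt_trans (ler_distD a b c) _; lra.
  by split; [apply: H x1 y1 | apply: H x2 y2].
have rU x : r x \in U x by rewrite mem_box !subrr normr0.
pose near_arc x y n := exists2 p, arc [set x; y] p & close_to s 2 n p.
have near_arc_U x y z n : e x y -> near_arc x y n -> n \in U z -> z \in [set x; y].
  move=> exy [p ap np] nU; apply: contraT => zxy.
  by case: (far_arc x y z p exy zxy ap); apply: near_U np nU.
(* the part of the edge xy before it first meets the box of y *)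
pose prefix (u : T * T) p := e u.1 u.2 -> exists z,
  [/\ path grid_adj (r u.1) p,
      forall w, w \in r u.1 :: p -> near_arc u.1 u.2 w /\ w \notin U u.2,
      grid_adj (last (r u.1) p) z & z \in U u.2].
have prefix_ex u : exists p, prefix u p.
  case: u => x y; case: (boolP (e x y)) => [exy|nxy]; last first.
    by exists [::]; rewrite /prefix /= (negbTE nxy).
  have xy : x != y by apply: contraTneq exy => ->; rewrite e_irr.
  have [_ /(_ x y exy)[g [cg _ g0 g1 arcE]] _ _] := drawing.
  have := arc_reach s0 cg; rewrite g0 g1 => H.
  have ry : ~~ (mem (U y)) (r x).
    by apply/negP => /(U_disj x y _ (rU x)) E; rewrite E eqxx in xy.
  have [p [z [p1 p2 p3 p4]]] := reach_first_hit H ry (rU y).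
  exists p => _; exists z; split=> // w /p2[[t [It ct]] wU]; split=> //.
  by exists (g t) => //; rewrite arcE; exists t.
have [pf pfP] := choice prefix_ex.
pose after x := [seq y <- enum T | e x y && (enum_rank x < enum_rank y)%N].
pose C x := U x ++ flatten [seq pf (x, y) | y <- after x].
have inC x n : n \in C x -> n \in U x \/ exists y,
    [/\ e x y, (enum_rank x < enum_rank y)%N & n \in pf (x, y)].
  rewrite mem_cat => /orP[nU|/flatten_mapP[y]]; first by left.
  by rewrite mem_filter mem_enum andbT => /andP[exy lt] ny; right; exists y.
have pfC x y n : e x y -> (enum_rank x < enum_rank y)%N ->
    n \in r x :: pf (x, y) -> n \in C x.
  move=> exy lt; rewrite inE => /orP[/eqP->|np]; first by rewrite mem_cat rU.
  rewrite mem_cat; apply/orP; right; apply/flatten_mapP; exists y => //.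
  by rewrite mem_filter exy lt mem_enum.
have pf_near x y n : e x y -> n \in pf (x, y) -> near_arc x y n /\ n \notin U y.
  move=> exy np; have [z [_ H _ _]] := pfP (x, y) exy.
  by apply: H; rewrite inE np orbT.
have pf_U x y z n : e x y -> n \in pf (x, y) -> n \in U z -> z = x.
  move=> exy np nU; have [na nUy] := pf_near x y n exy np.
  have := near_arc_U x y z n exy na nU; rewrite !inE => /orP[/eqP//|/eqP E].
  by rewrite -E nU in nUy.
exists C; split.
- move=> x y n /inC[nx|[y' [exy' lt1 nx]]] /inC[ny|[x' [eyx' lt2 ny]]].
  + exact: U_disj nx ny.
  + exact: pf_U eyx' ny nx.
  + by apply/esym; apply: pf_U exy' nx ny.
  apply/eqP; apply: contraT => xy; exfalso.
  have [[p ap np] nU1] := pf_near _ _ _ exy' nx.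
  have [[q aq nq] nU2] := pf_near _ _ _ eyx' ny.
  (* A box meeting both prefixes would belong to [x] and to [y] by [pf_U], so the common node lies
     outside all boxes and [far_arcs] applies. *)
  have noU v : n \notin U v.
    apply/negP => nv; case/eqP: xy.
    by rewrite -(pf_U _ _ _ _ exy' nx nv) (pf_U _ _ _ _ eyx' ny nv).
  (* Equal edges would force [y' = y] and [x' = x], and the two rank conditions would contradict
     each other. *)
  have ne : [set x; y'] != [set y; x'].
    apply: contraNneq xy => /setP E; have := E x; have := E y.
    rewrite !inE !eqxx /= => /orP[/eqP->//|/eqP E1] /esym/orP[/eqP->//|/eqP E2].
    by move: lt1 lt2; rewrite -E1 -E2; case: ltngtP.
  case: (far_arcs x y' y x' p q) => //.
  + by move=> v; apply: near_notU np (noU v).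
  + by move=> v; apply: near_notU nq (noU v).
  + exact: near_near np nq.
- by move=> x; apply: contraTneq (_ : r x \in C x) => [->|]; rewrite // mem_cat rU.
- have to_r x n : n \in C x -> reach (fun z => z \in C x) n (r x).
    move=> /inC[nU|[y [exy lt nx]]].
      by apply: reach_sub (box_reach nU) => z zU; rewrite mem_cat zU.
    have [z [p1 _ _ _]] := pfP (x, y) exy; apply: reach_sym.
    have np : n \in r x :: pf (x, y) by rewrite inE nx orbT.
    by apply: reach_sub (path_reach p1 np) => w; apply: pfC.
  move=> x n m /to_r nr /to_r/reach_sym rm; have [p [p1 p2 p3]] := reach_trans nr rm.
  by exists p; split=> // w wp; apply: p3; rewrite inE wp orbT.
have adj x y : e x y -> (enum_rank x < enum_rank y)%N ->
    exists n m, [/\ n \in C x, m \in C y & grid_adj n m].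
  move=> exy lt; have [z [p1 p2 p3 p4]] := pfP (x, y) exy.
  exists (last (r x) (pf (x, y))), z; split=> //; last by rewrite mem_cat p4.
  by apply: (pfC x y) => //; apply: mem_last.
move=> x y exy; case: (ltngtP (enum_rank x) (enum_rank y)) => [lt|gt|E].
- exact: adj.
- have [||n [m [nx my nm]]] := adj y x; rewrite // 1?e_sym //.
  by exists m, n; split=> //; rewrite grid_adj_sym.
by move: exy; rewrite (enum_rank_inj (val_inj E)) e_irr.
Qed.

(** * Conclusion for planar graphs *)

Lemma no_cycle_C4_free (T : finType) (e : rel T) :
  irreflexive e -> ~ has_cycle e 4 -> C4_free e.
Proof.
move=> e_irr no_C4 a b c d ab bc cd da ac bd; apply: no_C4.
exists [tuple a; b; c; d]; rewrite /ucycle /= ab bc cd da /=.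
rewrite !inE !negb_or ac bd !andbT.
by rewrite (e_neq e_irr ab) (e_neq e_irr bc) (e_neq e_irr cd) eq_sym (e_neq e_irr da).
Qed.

Lemma no_cycle_C5_free (T : finType) (e : rel T) :
  ~ has_cycle e 5 -> C5_free e.
Proof.
move=> no_C5 a b c d f ab bc cd df fa u; apply: no_C5.
by exists [tuple a; b; c; d; f]; rewrite /ucycle /= ab bc cd df fa.
Qed.

Theorem corollary1p2 (R : realType) (T : finType) (e : rel T)
    (e_sym : symmetric e) (e_irr : irreflexive e) (T_gt0 : (0 < #|T|)%N)
    (e_planar : planar R e)
    (no_C4 : ~ has_cycle e 4) (no_C5 : ~ has_cycle e 5) :
  3%:R / 11%:R <= independence_ratio e.
Proof.
have C4 := no_cycle_C4_free e_irr no_C4; have C5 := no_cycle_C5_free no_C5.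
have minor := planar_grid_minor e_sym e_irr e_planar.
have sparse S := @grid_minor_sparse T e S e_sym e_irr C4 C5 minor.
have [I [_ indI]] := independent_large e_sym e_irr C4 C5 sparse [set: T]%SET.
rewrite cardsT => le_I.
have le_alpha : (#|I| <= independence_number e)%N by apply: leq_bigmax_cond.
rewrite ler_pdivrMr ?ltr0n // mulrAC ler_pdivlMr ?ltr0n //.
rewrite -!natrM ler_nat; apply: leq_trans le_I _.
by rewrite mulnC leq_mul2r le_alpha orbT.
Qed.
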